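(* Let $S=K[X,Y]$ and let $I\in\mathcal F[2]$ be written as $$I=\sum_{i=0}^{r}\Phi_{i+1}\cdots\Phi_{r+1}\,S_{\beta_i}S,$$ with the notation of the context, and let $\Phi=\Phi_1\cdots\Phi_r$, $\delta=\deg\Phi$. If $\delta\ge 1$, let $$\Phi=H_1^{\mu_1}\cdots H_v^{\mu_v},\qquad \sum_{i=1}^v\mu_i=\delta,$$ be a factorization of $\Phi$ as a product of linear forms $H_1,\dots,H_v$ that are pairwise linearly independent (with $\mu_i\geq 1$). Then the number of strongly inessential elements appearing in every e-maximal basis of $I$ is $\delta-v$. If $\delta=0$, then $I=S_{\alpha}S$ (with $\alpha=\alpha(I)$) does not contain strongly inessential elements.
   Context: $K$ is an algebraically closed field, $S=K[X,Y]$, $\mathfrak M=(X,Y)$, and $S_t$ is the set of forms of degree $t$. A standard basis of a homogeneous ideal $I$ is an ordered set of forms generating $I$ such that its elements of degree $d$ define a $K$-basis of $I_d/(I_{d-1}S_1)$ for every $d$; $\nu(I)$ is its number of elements and $\alpha(I)$ the smallest degree of its elements. $\mathcal F[2]$ is the set of homogeneous (perfect) height $2$ ideals $I$ of $S$ with $\nu(I)=\alpha(I)+1$. Representation: every $I\in\mathcal F[2]$ can be written as $I=\sum_{i=0}^{r}\Phi_{i+1}\cdots\Phi_{r+1}S_{\beta_i}S$, where $r\ge 0$, $\Phi_1,\dots,\Phi_r$ are forms of positive degrees $\delta_1,\dots,\delta_r$, $\Phi_{r+1}=1$, $\beta_0\ge 0$, and $\beta_i=\beta_{i-1}+\delta_i+t_i$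 with $t_i>0$. Here $\Phi=\Phi_1\cdots\Phi_r$ (with $\Phi=1$ if $r=0$) is the greatest common divisor of the elements of $I$ of degree $\alpha(I)=\beta_0+\delta$. Given a standard basis $\mathcal B$ of $I$, an element $f\in\mathcal B$ is inessential with respect to $\mathcal B$ if there is $t\in\mathbb N$ with $f\,\mathfrak M^t\subseteq(\mathcal B\setminus\{f\})S$; otherwise it is essential. A form $f\in I_d$ is strongly inessential if $f\notin I_{d-1}S$ and $f$ is inessential with respect to every standard basis of $I$ containing it. A standard basis of $I$ is e-maximal if for every $d$ it has exactly $\nu_e(d)$ essential elements of degree $d$, where $\nu_e(d)$ is the greatest number of essential elements of degree $d$ appearing in a standard basis of $I$. *)

(* Defs.v *)
(* K[X,Y] is {mpoly K[2]} and the forms of degree t are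
   the t.-homog polynomials.  Note that 0 is t.-homog for every t. *)
From HB Require Import structures.
From mathcomp Require Import all_boot all_order all_algebra.
From mathcomp.multinomials Require Export mpoly.

Set Implicit Arguments.
Unset Strict Implicit.
Unset Printing Implicit Defensive.

Import GRing.Theory.
Local Open Scope ring_scope.

(* Subsets of K[X,Y], with Prop-valued membership: no decidability of ideal
   membership is built in (unlike the ideals of ring_quotient). *)
Definition polyset (K : closedFieldType) : Type := {mpoly K[2]} -> Prop.

Definition full (K : closedFieldType) : polyset K := fun=> True.

Definition same_set (K : closedFieldType) (A B : polyset K) : Prop :=
  forall f, A f <-> B f.

(* The finite sums of products a * b with a in A and b in B. *)
Definition setprod (K : closedFieldType) (A B : polyset K) : polyset K :=
  fun f => exists s : seq ({mpoly K[2]} * {mpoly K[2]}),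
    (forall p, p \in s -> A p.1 /\ B p.2) /\ f = \sum_(p <- s) p.1 * p.2.

(* The ideal G S generated by G. *)
Definition ideal_gen (K : closedFieldType) (G : polyset K) : polyset K :=
  setprod G (@full K).

Definition set_exp (K : closedFieldType) (A : polyset K) (t : nat) : polyset K :=
  iter t (setprod A) (@full K).

Definition maxideal (K : closedFieldType) : polyset K :=
  ideal_gen (fun f : {mpoly K[2]} => exists i : 'I_2, f = 'X_i).

Definition forms (K : closedFieldType) (t : nat) : polyset K :=
  fun f => f \is t.-homog.

(* A_d, and A_(d-1) with the convention A_(-1) = 0. *)
Definition deg_part (K : closedFieldType) (A : polyset K) (d : nat) : polyset K :=
  fun f => A f /\ forms d f.

Definition deg_part_pred (K : closedFieldType) (A : polyset K) (d : nat) :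
    polyset K :=
  if d is e.+1 then deg_part A e else fun f => f = 0.

Definition fdeg (K : closedFieldType) (f : {mpoly K[2]}) : nat := (msize f).-1.

Definition has_card (K : closedFieldType) (A : polyset K) (n : nat) : Prop :=
  exists s : seq {mpoly K[2]},
    [/\ uniq s, size s = n & forall f, f \in s <-> A f].

Definition is_ideal (K : closedFieldType) (I : polyset K) : Prop :=
  [/\ I 0, forall f g, I f -> I g -> I (f + g) & forall f g, I g -> I (f * g)].

Definition is_homogeneous (K : closedFieldType) (I : polyset K) : Prop :=
  forall f d, I f -> I (pihomog mdeg d f).

Definition is_prime (K : closedFieldType) (P : polyset K) : Prop :=
  [/\ is_ideal P, ~ P 1 & forall f g, P (f * g) -> P f \/ P g].

Definition prime_chain (K : closedFieldType) (Q : nat -> polyset K) (n : nat) :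
    Prop :=
  (forall i, (i <= n)%N -> is_prime (Q i)) /\
  (forall i, (i < n)%N ->
     (forall f, Q i f -> Q i.+1 f) /\ (exists f, Q i.+1 f /\ ~ Q i f)).

(* The height of the prime P is at least n. *)
Definition prime_height_ge (K : closedFieldType) (P : polyset K) (n : nat) :
    Prop :=
  exists Q, prime_chain Q n /\ same_set (Q n) P.

(* The minimum of the heights of the primes containing I is n; this fails for
   the unit ideal, which no prime contains. *)
Definition has_height (K : closedFieldType) (I : polyset K) (n : nat) : Prop :=
  (forall P, is_prime P -> (forall f, I f -> P f) -> prime_height_ge P n) /\
  (exists P, [/\ is_prime P, (forall f, I f -> P f) & ~ prime_height_ge P n.+1]).

(* The order of the sequence plays no role below.  The third and fourth clauses
   say that the classes of the elements of degree d span I_d/(I_(d-1) S_1) and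
   are linearly independent in it; the latter excludes 0 from B. *)
Definition standard_basis (K : closedFieldType) (I : polyset K)
    (B : seq {mpoly K[2]}) : Prop :=
  [/\ uniq B /\ (forall f, f \in B -> exists d, forms d f),
      same_set I (ideal_gen (fun f => f \in B)),
      forall (d : nat) (g : {mpoly K[2]}), deg_part I d g ->
        exists c : {mpoly K[2]} -> K,
          setprod (deg_part_pred I d) (forms 1)
            (g - \sum_(f <- B | f \is d.-homog) c f *: f)
    & forall (d : nat) (c : {mpoly K[2]} -> K),
        setprod (deg_part_pred I d) (@forms K 1)
          (\sum_(f <- B | f \is d.-homog) c f *: f) ->
        forall f, f \in B -> f \is d.-homog -> c f = 0].

Definition is_nu (K : closedFieldType) (I : polyset K) (n : nat) : Prop :=
  exists B, standard_basis I B /\ size B = n.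

Definition is_alpha (K : closedFieldType) (I : polyset K) (a : nat) : Prop :=
  exists B, [/\ standard_basis I B, (exists2 f, f \in B & fdeg f = a)
              & forall f, f \in B -> (a <= fdeg f)%N].

(* Perfection is not a separate clause: a homogeneous ideal I of height 2 in
   K[X,Y] has a quotient of finite length, hence Cohen-Macaulay, so I is
   automatically perfect. *)
Definition in_F2 (K : closedFieldType) (I : polyset K) : Prop :=
  [/\ is_ideal I, is_homogeneous I, has_height I 2
    & exists a, is_alpha I a /\ is_nu I a.+1].

(* I = sum_(0 <= i <= r) Phi_(i+1) ... Phi_(r+1) S_(beta_i) S; only the values
   Phi 1, ..., Phi r.+1, beta 0, ..., beta r, and delta i, t i for 1 <= i <= r
   matter. *)
Definition represents (K : closedFieldType) (I : polyset K) (r : nat)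
    (Phi : nat -> {mpoly K[2]}) (beta delta t : nat -> nat) : Prop :=
  [/\ forall i, (1 <= i <= r)%N ->
        [/\ Phi i != 0, (0 < delta i)%N & Phi i \is (delta i).-homog],
      Phi r.+1 = 1,
      forall i, (1 <= i <= r)%N ->
        (0 < t i)%N /\ beta i = (beta i.-1 + delta i + t i)%N
    & forall f, I f <->
        exists F : 'I_r.+1 -> {mpoly K[2]},
          (forall i : 'I_r.+1,
             ideal_gen (fun h => exists2 g, forms (beta i) g
               & h = (\prod_(i.+1 <= j < r.+2) Phi j) * g) (F i)) /\
          f = \sum_(i < r.+1) F i].

Definition inessential (K : closedFieldType) (B : seq {mpoly K[2]})
    (f : {mpoly K[2]}) : Prop :=
  exists t : nat, forall g, set_exp (@maxideal K) t g ->
    ideal_gen (fun h => h \in B /\ h <> f) (f * g).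

Definition essential_of_degree (K : closedFieldType) (B : seq {mpoly K[2]})
    (d : nat) : polyset K :=
  fun f => [/\ f \in B, forms d f & ~ inessential B f].

Definition strongly_inessential (K : closedFieldType) (I : polyset K) :
    polyset K :=
  fun f => exists d, [/\ deg_part I d f, ~ ideal_gen (deg_part_pred I d) f
    & forall B, standard_basis I B -> f \in B -> inessential B f].

Definition is_nu_e (K : closedFieldType) (I : polyset K) (d n : nat) : Prop :=
  (exists2 B, standard_basis I B & has_card (essential_of_degree B d) n) /\
  (forall B m, standard_basis I B -> has_card (essential_of_degree B d) m ->
     (m <= n)%N).

Definition e_maximal (K : closedFieldType) (I : polyset K)
    (B : seq {mpoly K[2]}) : Prop :=
  standard_basis I B /\
  forall d, exists2 n, is_nu_e I d n & has_card (essential_of_degree B d) n.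

Definition pairwise_independent (K : closedFieldType) (v : nat)
    (H : 'I_v -> {mpoly K[2]}) : Prop :=
  forall i j, i != j ->
    forall a b : K, a *: H i + b *: H j = 0 -> a = 0 /\ b = 0.

(* Main.v *)
Require Import Defs.
From HB Require Import structures.
From mathcomp Require Import all_boot all_order all_algebra.
From mathcomp.multinomials Require Import mpoly.
From Stdlib Require Import Classical.
From mathcomp Require Import ring zify.

Set Implicit Arguments.
Unset Strict Implicit.
Unset Printing Implicit Defensive.

Import GRing.Theory.
Local Open Scope ring_scope.

(** Everything is decided by the zeros of forms on the projective line.

    An element f of a standard basis B of I is essential exactly when some point
    z <> 0 of the plane detects it: f does not vanish at z while every other
    element of B does.  If f M^t lies in the ideal generated by B \ {f}, then f
    vanishes wherever B \ {f} does ([detected_essential]); conversely, if no point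
    detects f, the elements of B \ {f} have no common zero on the line, because I
    itself has none, so by the homogeneous Nullstellensatz ([nullstellensatz])
    they generate an ideal which contains a power of M ([essential_detected]).

    Put P_i = Phi_(i+1) ... Phi_r, e_i = deg P_i and d_i = beta_i + e_i.  The d_i
    increase with i, and for d_i <= d < d_(i+1) the forms of degree d of I are the
    multiples of P_i.  Hence, if l is the least index with P_l(z) <> 0, all forms of
    I of degree < d_l vanish at z and some form of degree d_l does not; an element
    detected by z must therefore have degree d_l ([detects_level]).  Points off
    the zeros of Phi = P_0 have l = 0, that is degree alpha = d_0, and the other
    points are, up to a scalar, the zeros p_1, ..., p_v of H_1, ..., H_v, for which
    this degree is > alpha.  So nu_e(alpha) <= dim I_alpha = beta_0 + 1, and for
    d > alpha, nu_e(d) is at most the number of the p_k of degree d, since one point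
    detects one element at most.

    Both bounds are reached by a single standard basis ([special_basis]), in which
    beta_0 + 1 points off Phi and all the p_k detect distinct elements.  It is
    obtained by interpolation ([point_basis]): I_(d_i) = P_i S_(beta_i), and beta_i
    is large enough for the values of a form of degree beta_i at all those of these
    points where P_i <> 0 to be prescribed.  This gives forms of degree d_i with
    prescribed values at the points of degree d_i, and allows every form of I_(d_i)
    to be modified by an element of I_(d_i - 1) S_1 so that it vanishes at the
    points of smaller degree.

    Now let B be e-maximal.  All its beta_0 + 1 elements of degree alpha are
    essential, and in every degree d > alpha there are as many essential elements as
    points p_k of degree d, so that each p_k detects an element of B
    ([roots_essential]) and v elements of degree > alpha are essential.  Any other
    element f vanishes at all the p_k of its degree, a property which does not
    involve B: no point can detect f in any standard basis, and f is strongly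
    inessential ([inessential_strong]).  As B has alpha + 1 = delta + beta_0 + 1
    elements, the number of these is delta - v.

    If delta = 0, then I is generated by the forms of degree alpha.  A form f of
    that degree which does not vanish at z belongs to the standard basis made of f
    and of a basis of the forms of degree alpha vanishing at z, and z detects it
    there ([not_strong_of_degree0]). *)

(** * Binary forms and univariate polynomials *)

Section Forms.
Variable K : closedFieldType.
Implicit Types (f g : {mpoly K[2]}) (q : {poly K}) (z w : 'I_2 -> K).

Lemma ord2P (i : 'I_2) : i = 0 \/ i = 1.
Proof. by case: i => -[|[|//]] hi; [left|right]; apply: val_inj. Qed.

(** The homogenization of q in degree N, with 'X_a as variable and 'X_b as
    homogenizing variable; the coefficients of q of index > N are lost. *)
Definition homz (a b : 'I_2) (N : nat) q : {mpoly K[2]} :=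
  \sum_(i < N.+1) q`_i *: ('X_a ^+ i * 'X_b ^+ (N - i)).

Lemma homzD a b N q1 q2 : homz a b N (q1 + q2) = homz a b N q1 + homz a b N q2.
Proof. by rewrite -big_split; apply: eq_bigr => i _; rewrite coefD scalerDl. Qed.

Lemma homzZ a b N (c : K) q : homz a b N (c *: q) = c *: homz a b N q.
Proof. by rewrite scaler_sumr; apply: eq_bigr => i _; rewrite coefZ scalerA. Qed.

Lemma homz0 a b N : homz a b N 0 = 0.
Proof. by apply: big1 => i _; rewrite coef0 scale0r. Qed.

Lemma homzXn a b N i : (i <= N)%N -> homz a b N 'X^i = 'X_a ^+ i * 'X_b ^+ (N - i).
Proof.
move=> leiN; rewrite /homz (bigD1 (inord i)) //= inordK // coefXn eqxx scale1r.
rewrite big1 ?addr0 // => j; rewrite -val_eqE /= inordK // => /negPf neq.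
by rewrite coefXn neq scale0r.
Qed.

Lemma homzMX a b N q : homz a b N.+1 (q * 'X) = 'X_a * homz a b N q.
Proof.
rewrite /homz big_ord_recl coefMX eqxx scale0r add0r mulr_sumr.
apply: eq_bigr => i _; rewrite lift0 coefMX /= subSS exprS.
by rewrite -scalerAr mulrA.
Qed.

Lemma homz_size a b N q :
  (size q <= N.+1)%N -> homz a b N.+1 q = 'X_b * homz a b N q.
Proof.
move=> szq; rewrite /homz big_ord_recr /= nth_default // scale0r addr0 mulr_sumr.
apply: eq_bigr => i _; rewrite -(scalerAr q`_i) subSn; last by rewrite -ltnS.
by rewrite exprS; congr (_ *: _); rewrite mulrCA.
Qed.

Lemma monomial_homog a b i j : ('X_a ^+ i * 'X_b ^+ j : {mpoly K[2]}) \is (i + j).-homog.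
Proof.
have dX (c : 'I_2) k : ('X_c ^+ k : {mpoly K[2]}) \is k.-homog.
  by rewrite -{2}[k]mul1n; apply: dhomogMn; rewrite dhomogX /= mdeg1.
exact: dhomogM.
Qed.

Lemma big_pair (R : Type) (idx : R) (op : Monoid.com_law idx) (a b : 'I_2) (F : 'I_2 -> R) :
  a != b -> \big[op/idx]_i F i = op (F a) (F b).
Proof.
move=> ab; rewrite (bigD1 a) // (bigD1 b) 1?eq_sym //= big_pred0 ?Monoid.mulm1 // => i.
by move: ab; case: a b i => [[|[|?]] ?] [[|[|?]] ?] [[|[|?]] ?].
Qed.

(** Binary forms of degree d are the homogenizations of the polynomials of degree
    at most d; this transports the arithmetic of K[x] to forms. *)
Lemma homz_exists a b d f : a != b -> f \is d.-homog ->
  exists2 q : {poly K}, (size q <= d.+1)%N & f = homz a b d q.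
Proof.
move=> ab /dhomogP hf; rewrite [f]mpolyE big_seq_cond.
elim/big_rec: _ => [|m p]; first by exists 0; rewrite ?size_poly0 // homz0.
rewrite andbT => /hf dm [q szq ->].
have {}dm : (m a + m b)%N = d by rewrite -dm /= mdegE (big_pair _ _ ab).
have lem : (m a <= d)%N by rewrite -dm leq_addr.
exists (f@_m *: 'X^(m a) + q).
  rewrite (leq_trans (size_polyD _ _)) // geq_max szq andbT.
  by rewrite (leq_trans (size_scale_leq _ _)) // size_polyXn ltnS.
rewrite homzD homzZ homzXn // -{2}dm addKn.
by rewrite mpolyXE_id (big_pair _ _ ab).
Qed.

Lemma homz_eval a b N q z : z b = 1 -> (size q <= N.+1)%N ->
  (homz a b N q).@[z] = q.[z a].
Proof.
move=> zb szq; rewrite (horner_coef_wide _ szq) raddf_sum /=.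
apply: eq_bigr => i _.
by rewrite mevalZ mevalM !rmorphXn /= !mevalXU zb expr1n mulr1.
Qed.

Lemma form_scale d f (c : K) z : f \is d.-homog ->
  f.@[fun i => c * z i] = c ^+ d * f.@[z].
Proof.
have n01 : (0 : 'I_2) != 1 by [].
move=> /(homz_exists n01) [q _ ->]; rewrite !raddf_sum /= mulr_sumr.
apply: eq_bigr => i _; rewrite !mevalZ !mevalM !rmorphXn /= !mevalXU !exprMn.
have -> : c ^+ d = c ^+ i * c ^+ (d - i) by rewrite -exprD subnKC // -ltnS.
by ring.
Qed.

End Forms.

(** * Points of the projective line and interpolation *)

Section Points.
Variable K : closedFieldType.
Implicit Types (f g u : {mpoly K[2]}) (q : {poly K}) (z w : 'I_2 -> K).

Lemma prod_homog (I : Type) (s : seq I) (P : pred I) (F : I -> {mpoly K[2]}) (d : I -> nat) :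
  (forall i, P i -> F i \is (d i).-homog) ->
  \prod_(i <- s | P i) F i \is (\sum_(i <- s | P i) d i).-homog.
Proof.
move=> hF; elim/big_rec2: _ => [|i e f Pi hf]; first exact: dhomog1.
by apply: dhomogM; [exact: hF|].
Qed.

(** The determinant of z and w: it vanishes exactly when the two vectors are
    proportional, and distinct points of the projective line are expressed by
    cross z w <> 0. *)
Definition cross z w : K := z 0 * w 1 - z 1 * w 0.

Lemma cross_self z : cross z z = 0.
Proof. by rewrite /cross mulrC subrr. Qed.

(** A linear form whose zeros are the multiples of z. *)
Definition lineform z : {mpoly K[2]} := z 0 *: 'X_1 - z 1 *: 'X_0.

Lemma linear_X_homog (i : 'I_2) : ('X_i : {mpoly K[2]}) \is 1.-homog.
Proof. by rewrite dhomogX /= mdeg1. Qed.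

Lemma lineform_homog z : lineform z \is 1.-homog.
Proof. by apply: rpredB; apply: rpredZ; apply: linear_X_homog. Qed.

Lemma lineform_eval z w : (lineform z).@[w] = cross z w.
Proof. by rewrite mevalB !mevalZ !mevalXU. Qed.

(** The product of the linear forms of the other points of A does not vanish at
    z k; a coordinate which is nonzero at z k raises its degree to m. *)
Lemma interpolation_delta (T : finType) (z : T -> 'I_2 -> K) (A : {set T}) (m : nat) (k : T) :
  (exists i, z k i != 0) -> {in A, forall j, j != k -> cross (z j) (z k) != 0} ->
  k \in A -> (#|A| <= m.+1)%N ->
  exists u, [/\ u \is m.-homog, u.@[z k] = 1
                     & {in A, forall j, j != k -> u.@[z j] = 0}].
Proof.
move=> [i zi] hA kA; rewrite (cardsD1 k) kA ltnS => cA.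
pose p : {mpoly K[2]} := (\prod_(j in A :\ k) lineform (z j)) * 'X_i ^+ (m - #|A :\ k|).
have pk : p.@[z k] != 0.
  rewrite mevalM rmorphXn rmorph_prod /= mevalXU mulf_neq0 ?expf_neq0 //.
  by apply/prodf_neq0 => j; rewrite !inE => /andP[jk jA]; rewrite lineform_eval hA.
exists (p.@[z k]^-1 *: p); split.
- have h1 : \prod_(j in A :\ k) lineform (z j) \is #|A :\ k|.-homog.
    by rewrite -sum1_card; apply: prod_homog => j _; apply: lineform_homog.
  have h2 := dhomogMn (m - #|A :\ k|) (linear_X_homog i).
  by apply: rpredZ; have := dhomogM h1 h2; rewrite mul1n subnKC.
- by rewrite mevalZ mulVf.
move=> j jA jk; rewrite mevalZ; set c := _^-1; rewrite mevalM rmorph_prod /= (bigD1 j) ?inE ?jk //=.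
by rewrite lineform_eval cross_self !mul0r mulr0.
Qed.

Lemma interpolation (T : finType) (z : T -> 'I_2 -> K) (A : {set T}) (m : nat) (y : T -> K) :
  (forall k, exists i, z k i != 0) ->
  (forall j k, j != k -> cross (z j) (z k) != 0) ->
  (#|A| <= m.+1)%N ->
  exists2 u, u \is m.-homog & {in A, forall k, u.@[z k] = y k}.
Proof.
move=> nz hA cA.
have /fin_all_exists [F hF] : forall k, exists u, k \in A ->
    [/\ u \is m.-homog, u.@[z k] = 1
      & {in A, forall j, j != k -> u.@[z j] = 0}].
  move=> k; case: (boolP (k \in A)) => kA; last by exists 0.
  have [|u hu] := interpolation_delta (nz k) _ kA cA; last by exists u.
  by move=> j _; apply: hA.
exists (\sum_(k in A) y k *: F k).
  by apply: rpred_sum => k /hF [hu _ _]; apply: rpredZ.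
move=> k kA; rewrite raddf_sum /= (bigD1 k) //= big1 ?addr0.
  by have [_ Fk _] := hF k kA; rewrite mevalZ Fk mulr1.
move=> j /andP[jA jk]; have [_ _ Fj] := hF j jA.
by rewrite mevalZ Fj ?mulr0 // eq_sym.
Qed.

Lemma avoid_roots (p : {poly K}) n : p != 0 ->
  exists s : seq K, [/\ uniq s, size s = n & all (fun x => ~~ root p x) s].
Proof.
move=> p0; elim: n => [|n [s [us szs hs]]]; first by exists [::].
have : p * \prod_(x <- s) ('X - x%:P) != 0.
  by rewrite mulf_neq0 // monic_neq0 // monic_prod_XsubC.
move/closed_nonrootP => [a]; rewrite rootM root_prod_XsubC negb_or => /andP[pa sa].
by exists (a :: s); rewrite /= sa us szs pa.
Qed.

Definition affine_pt (x : K) : 'I_2 -> K := fun i => if i == 0 then x else 1.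

Lemma cross_affine x y : cross (affine_pt x) (affine_pt y) = x - y.
Proof. by rewrite /cross /affine_pt /= mulr1 mul1r. Qed.

(** K is infinite, so the points (x, 1) off the zeros of f are infinitely many. *)
Lemma form_avoid d f n : f \is d.-homog -> f != 0 ->
  exists x : 'I_n -> K, injective x /\ forall i, f.@[affine_pt (x i)] != 0.
Proof.
move=> hf f0; have n01 : (0 : 'I_2) != 1 by [].
have [q szq fq] := homz_exists n01 hf.
have q0 : q != 0 by apply: contraNneq f0 => q0; rewrite fq q0 homz0.
have [s [us szs hs]] := avoid_roots n q0.
exists (fun i => nth 0 s i); split=> [i j|i].
  by move/eqP; rewrite nth_uniq ?szs ?ltn_ord // => /eqP/val_inj.
rewrite fq homz_eval // /affine_pt eqxx.
by apply: (allP hs); rewrite mem_nth // szs.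
Qed.

End Points.

(** * Linear independence modulo a subspace *)

Section RelativeIndependence.
Variables (F : fieldType) (M : lmodType F).
Implicit Types (W U : M -> Prop) (s : seq M).

Definition subspace W : Prop :=
  [/\ W 0, forall x y, W x -> W y -> W (x + y) & forall (a : F) x, W x -> W (a *: x)].

(** Independence modulo W in the shape in which standard bases use it: the
    coefficients are a function on M, which is harmless because s has no
    repetition. *)
Definition indep_mod W s : Prop :=
  uniq s /\ forall c : M -> F, W (\sum_(x <- s) c x *: x) -> {in s, forall x, c x = 0}.

Definition span_mod W s : M -> Prop :=
  fun y => exists c : M -> F, W (y - \sum_(x <- s) c x *: x).

Lemma subspaceB W x y : subspace W -> W x -> W y -> W (x - y).
Proof. by case=> _ WD WZ Wx Wy; rewrite -scaleN1r; apply: WD => //; apply: WZ. Qed.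

Lemma subspace_sum W (I : Type) (r : seq I) (P : pred I) (G : I -> M) :
  subspace W -> (forall i, P i -> W (G i)) -> W (\sum_(i <- r | P i) G i).
Proof. by case=> W0 WD _ hG; elim/big_ind: _. Qed.

Lemma span_subspace W s : subspace W -> subspace (span_mod W s).
Proof.
move=> hW; have [W0 WD WZ] := hW; split.
- by exists (fun=> 0); rewrite big1 ?subr0 // => x _; rewrite scale0r.
- move=> x y [c hc] [e he]; exists (fun v => c v + e v).
  have -> : \sum_(v <- s) (c v + e v) *: v =
            \sum_(v <- s) c v *: v + \sum_(v <- s) e v *: v.
    by rewrite -big_split; apply: eq_bigr => v _; rewrite scalerDl.
  by rewrite opprD addrACA; apply: WD.
- move=> a x [c hc]; exists (fun v => a * c v).
  rewrite (eq_bigr (fun v => a *: (c v *: v))); last by move=> v _; rewrite scalerA.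
  by rewrite -scaler_sumr -scalerBr; apply: WZ.
Qed.

Lemma sum_delta s (x : M) : uniq s -> x \in s ->
  \sum_(v <- s) (v == x)%:R *: v = x :> M.
Proof.
move=> us xs; rewrite (bigD1_seq x) //= eqxx scale1r big1 ?addr0 // => v /negPf ->.
by rewrite scale0r.
Qed.

Lemma mem_span_mod W s x : subspace W -> uniq s -> x \in s -> span_mod W s x.
Proof.
by case=> W0 _ _ us xs; exists (fun v => (v == x)%:R : F); rewrite sum_delta // subrr.
Qed.

Lemma span_mod_sub W s x : W x -> span_mod W s x.
Proof.
move=> Wx; exists (fun=> 0); rewrite big1 ?subr0 // => y _; exact: scale0r.
Qed.

(** Steinitz: if s had more than n elements, the matrix of their coordinates
    modulo W in the family e would have a nonzero vector in its left kernel, which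
    is a relation modulo W between the elements of s. *)
Lemma indep_mod_size W s n (e : 'I_n -> M) : subspace W -> indep_mod W s ->
  {in s, forall x, exists c : 'I_n -> F, W (x - \sum_(j < n) c j *: e j)} ->
  (size s <= n)%N.
Proof.
move=> hW [us hs] hse; rewrite leqNgt; apply/negP => lt_n_s.
have /fin_all_exists [C hC] : forall i : 'I_(size s),
    exists c : 'I_n -> F, W (s`_i - \sum_(j < n) c j *: e j).
  by move=> i; apply: hse; apply: mem_nth.
pose A := \matrix_(i < size s, j < n) C i j.
have : kermx A != 0.
  by rewrite kermx_eq0 /row_free neq_ltn (leq_ltn_trans (rank_leq_col A) lt_n_s).
case/rowV0Pn => v /sub_kermxP vA v0; case/negP: v0; apply/eqP/rowP => i.
have si : s`_i \in s by exact: mem_nth.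
(* The coefficients v of the relation, read as a function on the elements of s. *)
pose c x := if insub (index x s) is Some k then v 0 k else 0.
have cE (k : 'I_(size s)) : c s`_k = v 0 k.
  by rewrite /c index_uniq // (insubT (fun k => (k < size s)%N) (ltn_ord k)) /=;
     congr (v 0 _); apply: val_inj.
rewrite mxE -cE; apply: hs si => //.
have -> : \sum_(x <- s) c x *: x =
    \sum_(k < size s) v 0 k *: (s`_k - \sum_(j < n) C k j *: e j).
  rewrite (big_nth 0) big_mkord.
  rewrite [RHS](eq_bigr (fun k : 'I_(size s) =>
     v 0 k *: s`_k - \sum_(j < n) (v 0 k * C k j) *: e j)); last first.
    by move=> k _; rewrite scalerBr scaler_sumr; congr (_ - _);
       apply: eq_bigr => j _; rewrite scalerA.
  rewrite big_split /= sumrN exchange_big /= [X in _ - X]big1 ?subr0.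
    by apply: eq_bigr => k _; rewrite cE.
  move=> j _; rewrite -scaler_suml.
  have -> : \sum_(k < size s) v 0 k * C k j = 0; last exact: scale0r.
  move/rowP/(_ j): vA; rewrite !mxE => vAj; rewrite -[RHS]vAj.
  by apply: eq_bigr => k _; rewrite mxE.
by apply: subspace_sum => // k _; have [_ _ WZ] := hW; apply: WZ.
Qed.

Lemma indep_mod_cons W s x : subspace W -> indep_mod W s -> ~ span_mod W s x ->
  indep_mod W (x :: s).
Proof.
move=> hW [us hs] nx; have [W0 WD WZ] := hW; split=> [|c].
  by rewrite /= us andbT; apply/negP => /(mem_span_mod hW us).
rewrite big_cons => hc.
have cx : c x = 0.
  apply/eqP; apply/negPn/negP => cx; apply: nx.
  (* A relation with c x <> 0 expresses x by the elements of s. *)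
  exists (fun v => - (c x)^-1 * c v).
  rewrite (eq_bigr (fun v => - (c x)^-1 *: (c v *: v))); last first.
    by move=> v _; rewrite scalerA.
  rewrite -scaler_sumr scaleNr opprK.
  by move/(WZ (c x)^-1): hc; rewrite scalerDr scalerA mulVf // scale1r.
move: hc; rewrite cx scale0r add0r => /hs h v; rewrite inE => /predU1P[->|/h] //.
Qed.

(** Complete s0 as long as possible by elements of U: when the process stops,
    s ++ s0 generates U modulo W, and the bound n makes it stop. *)
Lemma indep_mod_extend W U n s0 : subspace W -> indep_mod W s0 ->
  (forall s, indep_mod W (s ++ s0) -> {in s, forall x, U x} -> (size s <= n)%N) ->
  exists s, [/\ {in s, forall x, U x}, indep_mod W (s ++ s0)
             & forall u, U u -> span_mod W (s ++ s0) u].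
Proof.
move=> hW h0 bound.
suff: forall k s, (n - size s <= k)%N -> indep_mod W (s ++ s0) -> {in s, forall x, U x} ->
    exists s, [/\ {in s, forall x, U x}, indep_mod W (s ++ s0)
             & forall u, U u -> span_mod W (s ++ s0) u].
  by move=> /(_ n [::]); apply => //; rewrite leq_subLR leq_addl.
elim=> [|k IH] s hk hs sU;
  case: (classic (forall u, U u -> span_mod W (s ++ s0) u)) => [|/not_all_ex_not [u nu]];
  try (by exists s).
all: have [Uu nsu] := imply_to_and _ _ nu.
all: have hus : indep_mod W ((u :: s) ++ s0) by apply: indep_mod_cons.
all: have usU : {in u :: s, forall x, U x} by move=> x; rewrite inE => /predU1P[->|/sU].
  by have := bound _ hus usU; move: hk => /=; lia.
by apply: (IH (u :: s)) => //=; lia.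
Qed.

(** The f k are independent modulo W because the functionals ev kill W.  Together
    with the common kernel U0 of the functionals in U they generate U, so that they
    can be completed to a basis modulo W by elements of U0 only. *)
Lemma adapted_basis W U n (T : finType) (A : {set T}) (ev : T -> M -> F) (f : T -> M) :
  subspace W -> subspace U ->
  (forall s, indep_mod W s -> {in s, forall x, U x} -> (size s <= n)%N) ->
  (forall k x y, ev k (x + y) = ev k x + ev k y) ->
  (forall k a x, ev k (a *: x) = a * ev k x) ->
  (forall k x, k \in A -> W x -> ev k x = 0) ->
  {in A, forall k, U (f k)} ->
  {in A &, forall j k, ev j (f k) = (j == k)%:R} ->
  exists s, [/\ {in s, forall x, U x}, {in s, forall x, {in A, forall k, ev k x = 0}},
     indep_mod W (s ++ [seq f k | k in A])
     & forall u, U u -> span_mod W (s ++ [seq f k | k in A]) u].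
Proof.
move=> hW hU bound evD evZ evW fU evf.
have ev0 k : ev k 0 = 0 by rewrite -(scale0r 0) evZ mul0r.
have ev_sum k (r : seq M) (c : M -> F) : ev k (\sum_(x <- r) c x *: x) = \sum_(x <- r) c x * ev k x.
  elim: r => [|x r IH]; first by rewrite !big_nil ev0.
  by rewrite !big_cons evD evZ IH.
have finj : {in A &, injective f}.
  move=> j k jA kA fjk; have := evf _ _ jA kA; rewrite -fjk evf // eqxx.
  by case: eqP => // _ /eqP; rewrite oner_eq0.
have h0 : indep_mod W [seq f k | k in A].
  split; first by rewrite map_inj_in_uniq ?enum_uniq // => j k; rewrite !mem_enum; apply: finj.
  move=> c hc x /imageP[k kA ->]; move: (evW k _ kA hc); rewrite ev_sum big_image /=.
  rewrite (bigD1 k) //= evf // eqxx mulr1 big1 ?addr0 // => j /andP[jA jk].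
  by rewrite evf // eq_sym (negPf jk) mulr0.
pose U0 x := U x /\ {in A, forall k, ev k x = 0}.
have [|s [sU hs sp]] := @indep_mod_extend W U0 n _ hW h0.
  move=> s [us hs] sU0; apply: bound; last by move=> x /sU0[].
  move: us; rewrite cat_uniq => /and3P[us /hasPn disj _]; split=> // c hc x xs.
  have := hs (fun v => if v \in s then c v else 0); rewrite big_cat /=.
  rewrite [X in X + _](_ : _ = \sum_(v <- s) c v *: v); last first.
    by rewrite !big_seq; apply: eq_bigr => v ->.
  rewrite [X in _ + X]big_seq [X in _ + X]big1 ?addr0; last first.
    by move=> v /disj /negPf -> ; rewrite scale0r.
  by move=> /(_ hc x); rewrite mem_cat xs; apply.
exists s; split=> //; first by move=> x /sU[].
  by move=> x /sU[].
move=> u Uu; have hsp := span_subspace (s ++ [seq f k | k in A]) hW.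
have [us _] := hs; have [_ UD UZ] := hU; have [_ spD spZ] := hsp.
rewrite -[u](subrK (\sum_(k in A) ev k u *: f k)); apply: spD.
  apply: sp; split.
    by apply: subspaceB => //; apply: subspace_sum => // k kA; apply/UZ/fU.
  move=> j jA; rewrite -scaleN1r evD evZ mulN1r.
  have -> : ev j (\sum_(k in A) ev k u *: f k) = \sum_(k in A) ev k u * ev j (f k).
    by elim/big_rec2: _ => [|k y1 y2 kA <-]; rewrite ?ev0 // evD evZ.
  rewrite (bigD1 j) //= evf // eqxx mulr1 big1 ?addr0 ?subrr // => k /andP[kA kj].
  by rewrite evf // eq_sym (negPf kj) mulr0.
apply: subspace_sum => // k kA; apply: spZ; apply: mem_span_mod => //.
by rewrite mem_cat map_f ?orbT // mem_enum.
Qed.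

End RelativeIndependence.

(** * Ideals, forms of a given degree, zeros of a form *)

Section Ideals.
Variable K : closedFieldType.
Implicit Types (f g u : {mpoly K[2]}) (q : {poly K}) (z w : 'I_2 -> K).
Implicit Types (A B I J : polyset K).

Lemma setprod_mul A B f g : A f -> B g -> setprod A B (f * g).
Proof.
by exists [:: (f, g)]; split=> [p|]; rewrite ?big_seq1 // inE => /eqP ->.
Qed.

Lemma setprod0 A B : setprod A B 0.
Proof. by exists [::]; rewrite big_nil. Qed.

Lemma setprodD A B f g : setprod A B f -> setprod A B g -> setprod A B (f + g).
Proof.
move=> [s [hs ->]] [r [hr ->]]; exists (s ++ r); rewrite big_cat; split=> // p.
by rewrite mem_cat => /orP[/hs|/hr].
Qed.

(** Additive induction on products of sets, and hence on generated ideals. *)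
Lemma setprod_ind A B (P : polyset K) : P 0 -> (forall f g, P f -> P g -> P (f + g)) ->
  (forall f g, A f -> B g -> P (f * g)) -> forall f, setprod A B f -> P f.
Proof.
move=> P0 PD PM f [s [hs ->]]; rewrite big_seq.
by elim/big_ind: _ => // p /hs[]; apply: PM.
Qed.

Lemma setprod_subspace A B : (forall (a : K) f, A f -> A (a *: f)) -> subspace (setprod A B).
Proof.
move=> AZ; split; [exact: setprod0|exact: setprodD|move=> a].
apply: setprod_ind; first by rewrite scaler0; apply: setprod0.
  by move=> f g; rewrite scalerDr; apply: setprodD.
by move=> f g Af Bg; rewrite scalerAl; apply: setprod_mul => //; apply: AZ.
Qed.

Lemma idealZ I (a : K) f : is_ideal I -> I f -> I (a *: f).
Proof. by case=> _ _ IM If; rewrite -mul_mpolyC; apply: IM. Qed.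

Lemma ideal_subspace I : is_ideal I -> subspace I.
Proof. by move=> hI; have [I0 ID _] := hI; split=> // a f; apply: idealZ. Qed.

Lemma ideal_mulr I f g : is_ideal I -> I f -> I (f * g).
Proof. by case=> _ _ IM If; rewrite mulrC; apply: IM. Qed.

Lemma ideal_gen_ideal A : is_ideal (ideal_gen A).
Proof.
split; [exact: setprod0|exact: setprodD|move=> f].
apply: setprod_ind; first by rewrite mulr0; apply: setprod0.
  by move=> g1 g2; rewrite mulrDr; apply: setprodD.
by move=> g1 g2 Ag _; rewrite mulrCA; apply: setprod_mul.
Qed.

Lemma ideal_gen_incl A f : A f -> ideal_gen A f.
Proof. by move=> Af; rewrite -[f]mulr1; apply: setprod_mul. Qed.

Lemma ideal_gen_min A I : is_ideal I -> (forall f, A f -> I f) ->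
  forall f, ideal_gen A f -> I f.
Proof.
move=> hI AI; have [I0 ID IM] := hI; apply: setprod_ind => // f g Af _.
by apply: ideal_mulr => //; apply: AI.
Qed.

Lemma forms_subspace d : subspace (@forms K d).
Proof.
by split=> [|f g|a f]; rewrite /forms; [apply: rpred0|apply: rpredD|apply: rpredZ].
Qed.

Lemma form_in_span d f : f \is d.-homog ->
  exists c : 'I_d.+1 -> K, f = \sum_(i < d.+1) c i *: ('X_0 ^+ i * 'X_1 ^+ (d - i)).
Proof.
have n01 : (0 : 'I_2) != 1 by [].
by move=> /(homz_exists n01)[q _ ->]; exists (fun i => q`_i).
Qed.

Lemma form_split a b f : f \is (a + b).-homog -> setprod (@forms K a) (@forms K b) f.
Proof.
move=> /form_in_span[c ->].
have hW : subspace (setprod (@forms K a) (@forms K b)).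
  by apply: setprod_subspace => e g; case: (forms_subspace a) => _ _; apply.
apply: subspace_sum => // i _; have [_ _] := hW; apply.
have [lia_|lai] := leqP i a.
  have -> : 'X_0 ^+ i * 'X_1 ^+ (a + b - i) =
      ('X_0 ^+ i * 'X_1 ^+ (a - i)) * ('X_0 ^+ 0 * 'X_1 ^+ b) :> {mpoly K[2]}.
    by rewrite expr0 mul1r -mulrA -exprD addnBAC.
  apply: setprod_mul; last exact: monomial_homog.
  by have := monomial_homog K 0 1 i (a - i); rewrite subnKC.
have -> : 'X_0 ^+ i * 'X_1 ^+ (a + b - i) =
    ('X_0 ^+ a * 'X_1 ^+ 0) * ('X_0 ^+ (i - a) * 'X_1 ^+ (a + b - i)) :> {mpoly K[2]}.
  by rewrite expr0 mulr1 mulrA -exprD subnKC // ltnW.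
apply: setprod_mul; first by have := monomial_homog K 0 1 a 0; rewrite addn0.
have := monomial_homog K 0 1 (i - a) (a + b - i).
by have -> : (i - a + (a + b - i) = b)%N by have := ltn_ord i; lia.
Qed.

Lemma indep_forms_size W d s : subspace W -> indep_mod W s ->
  {in s, forall f : {mpoly K[2]}, f \is d.-homog} -> (size s <= d.+1)%N.
Proof.
move=> hW hs sd.
apply: (indep_mod_size (e := fun i : 'I_d.+1 => 'X_0 ^+ i * 'X_1 ^+ (d - i)) hW hs).
move=> f /sd /form_in_span[c fc]; exists c; rewrite -fc subrr.
by case: hW.
Qed.

Lemma X_neq0 (i : 'I_2) : 'X_i != 0 :> {mpoly K[2]}.
Proof.
apply/eqP => /(congr1 (meval (fun=> 1))); rewrite mevalXU meval0 => /eqP.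
by rewrite oner_eq0.
Qed.

Lemma subspace_zero : subspace (fun f : {mpoly K[2]} => f = 0).
Proof.
by split=> [//|f g -> ->|a f ->]; rewrite ?addr0 ?scaler0.
Qed.

(** If A had more than d points, then in the degree m = #|A| - 1 >= d the forms
    dual to the points of A would be m + 1 independent forms, and a multiple of f
    of degree m, which vanishes on A, would be independent of them: too many for a
    space of dimension m + 1. *)
Lemma zeros_bound (T : finType) (z : T -> 'I_2 -> K) (A : {set T}) d f :
  (forall k, exists i, z k i != 0) ->
  (forall j k, j != k -> cross (z j) (z k) != 0) ->
  f \is d.-homog -> f != 0 -> {in A, forall k, f.@[z k] = 0} -> (#|A| <= d)%N.
Proof.
move=> nz hA hf f0 fA; rewrite leqNgt; apply/negP => ltdA.
pose m := #|A|.-1; have cA : #|A| = m.+1 by rewrite /m prednK // (leq_ltn_trans _ ltdA).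
have ledm : (d <= m)%N by rewrite -ltnS -cA.
have /fin_all_exists [F hF] : forall k, exists u, k \in A ->
    [/\ u \is m.-homog, u.@[z k] = 1
      & {in A, forall j, j != k -> u.@[z j] = 0}].
  move=> k; case: (boolP (k \in A)) => kA; last by exists 0.
  have [|u hu] := interpolation_delta (nz k) _ kA (eq_leq cA); last by exists u.
  by move=> j _; apply: hA.
pose g := f * 'X_0 ^+ (m - d).
have gm : g \is m.-homog.
  by have := dhomogM hf (dhomogMn (m - d) (linear_X_homog K 0)); rewrite mul1n subnKC.
have g0 : g != 0 by rewrite mulf_neq0 // expf_neq0 // X_neq0.
have gA : {in A, forall k, g.@[z k] = 0} by move=> k kA; rewrite mevalM fA // mul0r.
have Finj : {in A &, injective F}.
  move=> j k jA kA Fjk; have [_ Fj _] := hF j jA; have [_ _ /(_ j jA)] := hF k kA.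
  rewrite -Fjk Fj; case: eqP => // _ /(_ isT) /eqP.
  by rewrite oner_eq0.
have : indep_mod (fun f => f = 0) (g :: [seq F k | k in A]).
  split.
    rewrite /= map_inj_in_uniq ?enum_uniq ?andbT; last first.
      by move=> j k; rewrite !mem_enum; apply: Finj.
    apply/negP => /imageP[k kA gF]; have [_ Fk _] := hF k kA.
    by move/eqP: (gA k kA); rewrite gF Fk oner_eq0.
  move=> c; rewrite big_cons big_image /= => hc.
  have cF : {in A, forall k, c (F k) = 0}.
    move=> k kA; have := congr1 (meval (z k)) hc.
    rewrite meval0 mevalD mevalZ gA // mulr0 add0r raddf_sum /= (bigD1 k) //= big1 ?addr0.
      by have [_ Fk _] := hF k kA; rewrite mevalZ Fk mulr1.
    move=> j /andP[jA jk]; have [_ _ Fj] := hF j jA.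
    by rewrite mevalZ Fj ?mulr0 // eq_sym.
  move: hc; rewrite big1 ?addr0; last by move=> k /cF ->; rewrite scale0r.
  move/eqP; rewrite scaler_eq0 (negPf g0) orbF => /eqP cg x; rewrite inE.
  by case/predU1P => [->//|/imageP[k kA ->]]; apply: cF.
have Fm : {in g :: [seq F k | k in A], forall h : {mpoly K[2]}, h \is m.-homog}.
  by move=> h; rewrite inE => /predU1P[->//|/imageP[k kA ->]]; have [] := hF k kA.
move=> /(indep_forms_size subspace_zero) /(_ Fm).
by rewrite /= size_map -cardE cA ltnn.
Qed.

End Ideals.

(** * The homogeneous Nullstellensatz and the detection of essential elements *)

Section Nullstellensatz.
Variable K : closedFieldType.
Implicit Types (f g u : {mpoly K[2]}) (q : {poly K}) (z w : 'I_2 -> K).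
Implicit Types (A B I J : polyset K) (s : seq {mpoly K[2]}).

(** For a homogeneous ideal J, the q with this property form the dehomogenization
    of J at 'X_b = 1. *)
Definition eventually_in (a b : 'I_2) J q : Prop :=
  exists N0, forall N, (N0 <= N)%N -> J (homz a b N q).

Lemma eventually_inD a b J q1 q2 : is_ideal J ->
  eventually_in a b J q1 -> eventually_in a b J q2 -> eventually_in a b J (q1 + q2).
Proof.
move=> [_ JD _] [N1 h1] [N2 h2]; exists (maxn N1 N2) => N.
by rewrite geq_max homzD => /andP[le1 le2]; apply: JD; [apply: h1|apply: h2].
Qed.

Lemma eventually_inM a b J p q : is_ideal J ->
  eventually_in a b J q -> eventually_in a b J (p * q).
Proof.
move=> hJ hq; have [J0 JD JM] := hJ; elim/poly_ind: p => [|p c IH].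
  by rewrite mul0r; exists 0%N => N _; rewrite homz0.
rewrite mulrDl mul_polyC; apply: eventually_inD => //.
  rewrite mulrAC; have [N0 h] := IH; exists N0.+1 => -[//|N] leN.
  by rewrite homzMX; apply: JM; apply: h.
by have [N0 h] := hq; exists N0 => N leN; rewrite homzZ; apply: idealZ => //; apply: h.
Qed.

Lemma eventually_in_form a b J d q : is_ideal J -> (size q <= d.+1)%N ->
  J (homz a b d q) -> eventually_in a b J q.
Proof.
move=> [_ _ JM] szq Jq; exists d; elim=> [|N IH].
  by rewrite leqn0 => /eqP <-.
rewrite leq_eqVlt => /predU1P[<-//|ltdN].
by rewrite homz_size ?(leq_trans szq) //; apply: JM; apply: IH.
Qed.

(** Bezout: an ideal of K[x] which contains finitely many polynomials contains
    their greatest common divisor. *)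
Lemma common_divisor a b J s : a != b -> is_ideal J ->
  {in s, forall g, J g /\ exists d, g \is d.-homog} ->
  exists2 D, eventually_in a b J D
    & {in s, forall g, exists d q, [/\ (size q <= d.+1)%N, g = homz a b d q & D %| q]}.
Proof.
move=> ab hJ; elim: s => [|g s IH] hs.
  by exists 0 => //; exists 0%N => N _; rewrite homz0; case: hJ.
have [|D JD hD] := IH; first by move=> h hin; apply: hs; rewrite inE hin orbT.
have [Jg [d hg]] := hs g (mem_head _ _); have [q szq gq] := homz_exists ab hg.
have [[u v] /= huv] := Bezoutp q D.
exists (u * q + v * D).
  apply: eventually_inD => //; apply: eventually_inM => //.
  by apply: (@eventually_in_form _ _ _ d) => //; rewrite -gq.
move=> h; rewrite inE => /predU1P[->|/hD].
  by exists d, q; split=> //; rewrite (eqp_dvdl _ huv) dvdp_gcdl.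
move=> [e [p [szp hp Dp]]]; exists e, p; split=> //.
by rewrite (eqp_dvdl _ huv) (dvdp_trans _ Dp) // dvdp_gcdr.
Qed.

(** A root x of the common divisor would give the common zero with coordinates x
    and 1 of all elements of s.  So the common divisor is a nonzero constant, and
    the homogenizations of 1 are the powers of 'X_b. *)
Lemma power_in_ideal a b J s : a != b -> is_ideal J ->
  {in s, forall g, J g /\ exists d, g \is d.-homog} ->
  (forall z, (exists i, z i != 0) -> exists2 g, g \in s & g.@[z] != 0) ->
  exists N, J ('X_b ^+ N).
Proof.
move=> ab hJ hs nozero; have [D [N0 JD] Ds] := common_divisor ab hJ hs.
have szD : size D == 1%N.
  apply/negPn/negP => /closed_rootP[x Dx].
  pose z (i : 'I_2) := if i == a then x else 1.
  have zb : z b = 1 by rewrite /z eq_sym (negPf ab).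
  have [|g /Ds[d [q [szq gq Dq]]]] := nozero z; first by exists b; rewrite zb oner_neq0.
  rewrite gq homz_eval // /z eqxx => /negP; apply.
  by apply: (root_dvdp Dq).
have [c c0 Dc] := size_poly1P _ szD; exists N0.
have -> : 'X_b ^+ N0 = c^-1 *: homz a b N0 D.
  rewrite -homzZ Dc -mul_polyC -polyCM mulVf //.
  by have := homzXn K a b (leq0n N0); rewrite !expr0 mul1r subn0.
by apply: idealZ => //; apply: JD.
Qed.

(** Both affine charts of the projective line are used, one for each variable. *)
Lemma nullstellensatz J s : is_ideal J ->
  {in s, forall g, J g /\ exists d, g \is d.-homog} ->
  (forall z, (exists i, z i != 0) -> exists2 g, g \in s & g.@[z] != 0) ->
  exists N, forall i : 'I_2, J ('X_i ^+ N).
Proof.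
move=> hJ hs nz; have n01 : (0 : 'I_2) != 1 by [].
have n10 : (1 : 'I_2) != 0 by [].
have [N1 h1] := power_in_ideal n01 hJ hs nz; have [N0 h0] := power_in_ideal n10 hJ hs nz.
have mono i n m : (n <= m)%N -> J ('X_i ^+ n) -> J ('X_i ^+ m).
  by move=> /subnKC <- ?; rewrite exprD; apply: ideal_mulr.
exists (maxn N0 N1) => i; have [->|->] := ord2P i.
  by apply: mono h0; rewrite leq_maxl.
by apply: mono h1; rewrite leq_maxr.
Qed.

Lemma set_exp_maxideal_X t (i : 'I_2) : set_exp (@maxideal K) t ('X_i ^+ t).
Proof.
elim: t => [//|t IH]; rewrite exprS; apply: setprod_mul => //.
by apply: ideal_gen_incl; exists i.
Qed.

(** Each of the t factors from the maximal ideal contributes a variable; as soon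
    as 2N variables have been collected, one of them occurs at least N times. *)
Lemma maxideal_power_sub J N : is_ideal J -> (forall i : 'I_2, J ('X_i ^+ N)) ->
  forall t g, set_exp (@maxideal K) t g ->
  forall a b, (N.*2 <= a + b + t)%N -> J ('X_0 ^+ a * 'X_1 ^+ b * g).
Proof.
move=> hJ JX; have [J0 JD JM] := hJ; elim=> [|t IH].
  move=> g _ a b; rewrite addn0 => le2N; apply: ideal_mulr => //.
  have [leNa|ltaN] := leqP N a.
    by rewrite -(subnK leNa) exprD -mulrA; apply: JM; apply: ideal_mulr.
  have leNb : (N <= b)%N by move: le2N; rewrite -addnn; lia.
  by rewrite -(subnK leNb) exprD mulrA; apply: JM.
change (set_exp (@maxideal K) t.+1) with (setprod (@maxideal K) (set_exp (@maxideal K) t)).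
apply: setprod_ind.
- by move=> a b _; rewrite mulr0.
- by move=> f1 f2 h1 h2 a b le2N; rewrite mulrDr; apply: JD; [apply: h1|apply: h2].
move=> m h hm hh; move: m hm; apply: setprod_ind.
- by move=> a b _; rewrite mul0r mulr0.
- by move=> f1 f2 h1 h2 a b le2N; rewrite mulrDl mulrDr; apply: JD; [apply: h1|apply: h2].
move=> _ c [i ->] _ a b le2N.
have [->|->] := ord2P i.
- have -> : 'X_0 ^+ a * 'X_1 ^+ b * ('X_0 * c * h) = c * ('X_0 ^+ a.+1 * 'X_1 ^+ b * h).
    by rewrite exprS; ring.
  by apply: JM; apply: IH => //; rewrite !addSn -addnS.
- have -> : 'X_0 ^+ a * 'X_1 ^+ b * ('X_1 * c * h) = c * ('X_0 ^+ a * 'X_1 ^+ b.+1 * h).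
    by rewrite exprS; ring.
  by apply: JM; apply: IH => //; rewrite addnS addSn -addnS.
Qed.

Lemma vanish_ideal A z : (forall g, A g -> g.@[z] = 0) ->
  forall g, ideal_gen A g -> g.@[z] = 0.
Proof.
move=> hA; apply: setprod_ind; first exact: meval0.
  by move=> f g hf hg; rewrite mevalD hf hg addr0.
by move=> f g Af _; rewrite mevalM hA // mul0r.
Qed.

(** The point z witnesses that f is essential in s. *)
Definition detects s z f : Prop :=
  [/\ exists i, z i != 0, f.@[z] != 0 & forall g, g \in s -> g != f -> g.@[z] = 0].

(** Ideal generators which vanish at z force f * 'X_i ^+ t to vanish at z, where
    i is a nonzero coordinate of z. *)
Lemma detected_essential s z f : detects s z f -> ~ inessential s f.
Proof.
move=> [[i zi] fz sz] [t ht]; have /vanish_ideal := ht _ (set_exp_maxideal_X t i).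
move=> /(_ z) h; have /eqP := h (fun g hg => sz g hg.1 (introN eqP hg.2)).
by rewrite mevalM rmorphXn /= mevalXU mulf_eq0 (negPf fz) expf_eq0 (negPf zi) andbF.
Qed.

(** I has no common zero, since it contains powers of the variables.  Therefore a
    common zero z of the elements other than f is not a zero of f, that is, z
    detects f; without such a z the Nullstellensatz applies to these elements. *)
Lemma essential_detected I s N f : (forall i : 'I_2, I ('X_i ^+ N)) ->
  same_set I (ideal_gen (fun f => f \in s)) ->
  {in s, forall g, exists d, g \is d.-homog} ->
  f \in s -> ~ inessential s f -> exists z, detects s z f.
Proof.
move=> IX Is sh fs ess; apply: NNPP => nodet; apply: ess.
pose J := ideal_gen (fun h => h \in s /\ h <> f).
have hJ : is_ideal J by apply: ideal_gen_ideal.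
have [N1 hN1] : exists N, forall i : 'I_2, J ('X_i ^+ N).
  apply: (@nullstellensatz J [seq h <- s | h != f]) => //.
    move=> h; rewrite mem_filter => /andP[hf hs]; split; last exact: sh.
    by apply: ideal_gen_incl; split=> //; apply/eqP.
  move=> z zi; apply: NNPP => noz; apply: nodet; exists z.
  have others g : g \in s -> g != f -> g.@[z] = 0.
    move=> gs gf; apply/eqP/negPn/negP => gz; apply: noz; exists g => //.
    by rewrite mem_filter gf.
  split=> //; apply/eqP => fz; have [i /negP zi'] := zi; apply: zi'.
  have /Is /vanish_ideal := IX i; move=> /(_ z).
  rewrite rmorphXn /= mevalXU => h; suff : z i ^+ N == 0 by rewrite expf_eq0 => /andP[].
  by apply/eqP/h => g gs; have [->//|] := eqVneq g f; apply: others.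
exists N1.*2 => g hg.
have := @maxideal_power_sub J N1 hJ hN1 _ _ hg 0 0; rewrite !expr0 !mul1r.
by move=> h; have [_ _ JM] := hJ; apply: JM; apply: h; rewrite !add0n.
Qed.

End Nullstellensatz.

(** * Standard bases *)

Section Standard.
Variable K : closedFieldType.
Implicit Types (f g u : {mpoly K[2]}) (q : {poly K}) (z w : 'I_2 -> K).
Implicit Types (A I J : polyset K) (s B : seq {mpoly K[2]}).

Lemma pihomogMl d D f g : f \is d.-homog ->
  pihomog mdeg D (f * g) = if (d <= D)%N then f * pihomog mdeg (D - d) g else 0.
Proof.
move=> hf; have [k hk] : exists k, (msize g <= k)%N by exists (msize g).
rewrite {1}(pihomog_partitionE hk) mulr_sumr raddf_sum /=.
have piE (i : 'I_k) : pihomog mdeg D (f * pihomog mdeg i g) =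
    if (d + i == D)%N then f * pihomog mdeg i g else 0.
  have h := dhomogM hf (pihomogP mdeg i g).
  by case: eqVneq => [e|ne]; [apply: pihomog_dE; rewrite -e|apply: (pihomog_ne0 ne)].
rewrite (eq_bigr _ (fun i _ => piE i)) -big_mkcond /=.
have [ledD|ltDd] := leqP d D; last first.
  by rewrite big1 // => i /eqP e; move: ltDd; rewrite -e ltnNge leq_addr.
have [ltk|lek] := ltnP (D - d) k.
  have Pj : (d + Ordinal ltk == D)%N by rewrite /= subnKC.
  rewrite (bigD1 _ Pj) /=.
  rewrite big1 ?addr0 // => i /andP[/eqP e].
  by rewrite -val_eqE /= -e addKn eqxx.
rewrite big1 => [|i /eqP e]; last by have := ltn_ord i; lia.
rewrite [g](pihomog_partitionE hk) raddf_sum /= big1 ?mulr0 // => i _.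
by apply: (pihomog_ne0 _ (pihomogP mdeg i g)); have := ltn_ord i; lia.
Qed.

(** The subspace I_(d-1) S_1 of I_d. *)
Definition decomposable I d : polyset K := setprod (deg_part_pred I d) (@forms K 1).

Lemma deg_part_predZ I d (a : K) f : is_ideal I ->
  deg_part_pred I d f -> deg_part_pred I d (a *: f).
Proof.
move=> hI; case: d => [|d] /=; first by move=> ->; rewrite scaler0.
by case=> If df; split; [apply: idealZ|apply: rpredZ].
Qed.

Lemma decomposable_subspace I d : is_ideal I -> subspace (decomposable I d).
Proof. by move=> hI; apply: setprod_subspace => a f; apply: deg_part_predZ. Qed.

Lemma deg_part_subspace I d : is_ideal I -> subspace (deg_part I d).
Proof.
move=> /ideal_subspace[I0 ID IZ]; have [F0 FD FZ] := @forms_subspace K d.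
split=> [|f g [? ?] [? ?]|a f [? ?]]; split; by [|apply: ID|apply: FD|apply: IZ|apply: FZ].
Qed.

Lemma decomposable_sub I d f : is_ideal I -> decomposable I d f -> deg_part I d f.
Proof.
move=> hI; have [I0 ID IM] := deg_part_subspace d hI.
apply: setprod_ind => // g h; case: d I0 ID IM => [|d] I0 ID IM /=.
  by move=> -> _; rewrite mul0r.
by case=> Ig dg dh; split; [apply: ideal_mulr|have := dhomogM dg dh; rewrite addn1].
Qed.

Lemma decomposable_gen I d f :
  decomposable I d f -> ideal_gen (deg_part_pred I d) f.
Proof.
apply: setprod_ind; [exact: setprod0|exact: setprodD|move=> g h Ig _].
exact: setprod_mul.
Qed.

(** Only the part of degree 1 of the cofactors contributes to the part of degree
    d of an element of the ideal generated by I_(d-1). *)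
Lemma gen_decomposable I d f : forms d f ->
  ideal_gen (deg_part_pred I d) f -> decomposable I d f.
Proof.
move=> hf; rewrite -[f in decomposable _ _ f](pihomog_dE hf).
move: f {hf}; apply: setprod_ind.
- by rewrite pihomog0; apply: setprod0.
- by move=> f g; rewrite pihomogD; apply: setprodD.
move=> g h; case: d => [|d] /=.
  by move=> -> _; rewrite mul0r pihomog0; apply: setprod0.
move=> hg _; rewrite (pihomogMl _ _ hg.2) leqnSn subSnn.
by apply: setprod_mul => //; apply: pihomogP.
Qed.

Section Invariance.
Variables (I : polyset K) (hI : is_ideal I).

Definition in_degree d B := [seq f <- B | f \is d.-homog].

Lemma standard_indep B d : standard_basis I B -> indep_mod (decomposable I d) (in_degree d B).
Proof.
move=> [[uB _] _ _ hB]; split; first exact: filter_uniq.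
move=> c; rewrite big_filter => /hB h f; rewrite mem_filter => /andP[df fB].
exact: h.
Qed.

Lemma standard_span B d f : standard_basis I B -> deg_part I d f ->
  span_mod (decomposable I d) (in_degree d B) f.
Proof. by move=> [_ _ hB _] /hB[c hc]; exists c; rewrite big_filter. Qed.

Lemma standard_in B f : standard_basis I B -> f \in B -> I f.
Proof. by move=> [_ IB _ _] fB; apply/IB; apply: ideal_gen_incl. Qed.

Lemma indep_neq0 (W : polyset K) s f : subspace W -> indep_mod W s -> f \in s -> f != 0.
Proof.
move=> [W0 _ _] [us hs] fs; apply/eqP => f0.
have := hs (fun g => (g == f)%:R) _ f fs; rewrite eqxx sum_delta // f0 => /(_ W0)/eqP.
by rewrite oner_eq0.
Qed.

Lemma standard_neq0 B f : standard_basis I B -> f \in B -> f != 0.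
Proof.
move=> hB fB; have [[_ /(_ f fB)[d df]] _ _ _] := hB.
apply: (indep_neq0 (decomposable_subspace d hI) (standard_indep d hB)).
by rewrite mem_filter fB andbT.
Qed.

(** Both families are bases of I_d modulo I_(d-1) S_1. *)
Lemma in_degree_size_le B B' d : standard_basis I B -> standard_basis I B' ->
  (size (in_degree d B) <= size (in_degree d B'))%N.
Proof.
move=> hB hB'; apply: (indep_mod_size (e := fun i : 'I__ => (in_degree d B')`_i)
   (decomposable_subspace d hI) (standard_indep d hB)) => f.
rewrite mem_filter => /andP[df fB].
have [c hc] := standard_span hB' (conj (standard_in hB fB) df).
by exists (fun i => c (in_degree d B')`_i); move: hc; rewrite (big_nth 0) big_mkord.
Qed.

Lemma size_in_degree B N : standard_basis I B ->
  {in B, forall f d, f \is d.-homog -> (d < N)%N} ->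
  size B = \sum_(d < N) size (in_degree d B).
Proof.
move=> hB BN; under eq_bigr => d _ do rewrite /in_degree size_filter -sum1_count big_mkcond.
rewrite exchange_big /= -sum1_size !big_seq; apply: eq_bigr => f fB.
have [[_ /(_ f fB)[d df]] _ _ _] := hB; have ltdN := BN f fB d df.
rewrite (bigD1 (Ordinal ltdN)) //= [f \is _]df big1 // => e; rewrite -val_eqE /= => ne.
case: ifP => // de; case/eqP: ne.
exact: (dhomog_uniq (standard_neq0 hB fB) de df).
Qed.

Lemma standard_degree_bound B : standard_basis I B ->
  exists N, {in B, forall f d, f \is d.-homog -> (d < N)%N}.
Proof.
move=> hB; exists (\max_(f <- B) msize f) => f fB d df.
rewrite (leq_trans _ (leq_bigmax_seq _ fB _)) //.
have f0 := standard_neq0 hB fB; have := dhomog_msize df => /(dhomog_uniq f0 df) ->.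
by rewrite prednK // lt0n mmeasure_poly_eq0.
Qed.

Lemma standard_size_eq B B' : standard_basis I B -> standard_basis I B' -> size B = size B'.
Proof.
move=> hB hB'; have [N1 h1] := standard_degree_bound hB.
have [N2 h2] := standard_degree_bound hB'.
rewrite (@size_in_degree B (maxn N1 N2)) //; last first.
  by move=> f fB d /(h1 f fB); rewrite leq_max => ->.
rewrite (@size_in_degree B' (maxn N1 N2)) //; last first.
  by move=> f fB d /(h2 f fB); rewrite leq_max orbC => ->.
by apply: eq_bigr => d _; apply/eqP; rewrite eqn_leq !in_degree_size_le.
Qed.

End Invariance.
End Standard.

(** * Standard bases adapted to a family of points *)

Section Construction.
Variable K : closedFieldType.
Implicit Types (f g u : {mpoly K[2]}) (q : {poly K}) (w : 'I_2 -> K).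
Implicit Types (s B : seq {mpoly K[2]}).
Variables (I : polyset K) (N : nat) (T : finType) (z : T -> 'I_2 -> K) (l : T -> nat).
Variable F : T -> {mpoly K[2]}.
Hypotheses (hI : is_ideal I) (homI : is_homogeneous I).
Hypothesis top : forall d g, (N <= d)%N -> deg_part I d g -> decomposable I d g.
Hypothesis FI : forall k, deg_part I (l k) (F k).
Hypothesis Fz : forall k, (F k).@[z k] != 0.
Hypothesis Fz0 : forall j k, (l j <= l k)%N -> j != k -> (F k).@[z j] = 0.
(* l k is the least degree in which I has a form that is nonzero at z k. *)
Hypothesis below : forall k e g, (e < l k)%N -> deg_part I e g -> g.@[z k] = 0.
(* Modulo I_(d-1) S_1 the values at the points of smaller level can be removed. *)
Hypothesis adjust : forall d h, deg_part I d h -> exists2 w, decomposable I d w &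
  forall k, (l k < d)%N -> (h - w).@[z k] = 0.

Let W d := decomposable I d.

(** By [below], I_(d-1) vanishes at z k for d = l k. *)
Lemma decomposable_vanish k g : W (l k) g -> g.@[z k] = 0.
Proof.
move: g; apply: setprod_ind; first exact: meval0.
  by move=> f h hf hh; rewrite mevalD hf hh addr0.
move=> f h hf _; rewrite mevalM [X in X * _](_ : _ = 0) ?mul0r //.
case e: (l k) hf => [|d] /=; first by move=> ->; rewrite meval0.
by apply: below; rewrite e.
Qed.

(** The forms of degree d of I which vanish at the points of level < d generate
    I_d modulo I_(d-1) S_1, by [adjust]; in this space the F k of degree d are dual
    to the points of level d, up to the scalars F k (z k). *)
Lemma basis_degree d : exists b : seq {mpoly K[2]},
  [/\ {in b, forall x, deg_part I d x}, indep_mod (W d) b,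
      forall h, deg_part I d h -> span_mod (W d) b h,
      forall k, l k = d -> F k \in b
    & forall k x, (l k <= d)%N -> x \in b -> x != F k -> x.@[z k] = 0].
Proof.
pose U h := deg_part I d h /\ forall k, (l k < d)%N -> h.@[z k] = 0.
pose A := [set k | l k == d].
have hW : subspace (W d) := decomposable_subspace d hI.
have [I0 ID IZ] := deg_part_subspace d hI.
have hU : subspace U.
  split=> [|f g [If hf] [Ig hg]|a f [If hf]].
  - by split=> // k _; apply: meval0.
  - by split=> [|k lk]; [apply: ID|rewrite mevalD hf // hg // addr0].
  - by split=> [|k lk]; [apply: IZ|rewrite mevalZ hf // mulr0].
have inA k : (k \in A) = (l k == d) by rewrite inE.
have [||||||s [sU sz hs sp]] := @adapted_basis _ _ (W d) U d.+1 T A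
    (fun k x => x.@[z k] / (F k).@[z k]) F hW hU.
- by move=> s hs sU; apply: (indep_forms_size hW hs) => f /sU[[]].
- by move=> k x y; rewrite mevalD mulrDl.
- by move=> k a x; rewrite mevalZ mulrA.
- by move=> k x; rewrite inA => /eqP <- /decomposable_vanish ->; rewrite mul0r.
- move=> k; rewrite inA => /eqP lk; split; first by rewrite -lk.
  move=> j; rewrite -lk => lt; apply: Fz0; first exact: ltnW.
  by apply: contraTneq lt => ->; rewrite ltnn.
- move=> j k; rewrite !inA => /eqP lj /eqP lk; have [->|ne] := eqVneq j k.
    by rewrite divff.
  by rewrite Fz0 ?mul0r // lj lk.
exists (s ++ [seq F k | k in A]); split=> //.
- by move=> x; rewrite mem_cat => /orP[/sU[]//|/imageP[k]]; rewrite inA => /eqP <- ->.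
- move=> h Ih; have [w Ww hw] := adjust Ih.
  have [_ spD _] := span_subspace (s ++ [seq F k | k in A]) hW.
  rewrite -[h](subrK w); apply: spD; last exact: span_mod_sub.
  apply: sp; split=> //; apply: subspaceB => //; exact: decomposable_sub.
- by move=> k lk; rewrite mem_cat map_f ?orbT // mem_enum inA lk.
move=> k x lkd; rewrite mem_cat => /orP[xs _|/imageP[j]].
  move: lkd; rewrite leq_eqVlt => /predU1P[lk|lk]; last by have [_] := sU _ xs; apply.
  have := sz x xs k; rewrite inA lk eqxx => /(_ isT)/eqP.
  by rewrite mulf_eq0 invr_eq0 (negPf (Fz k)) orbF => /eqP.
rewrite inA => /eqP lj -> ne; apply: Fz0; first by rewrite lj.
by apply: contraNneq ne => ->.
Qed.

Lemma level_lt k : (l k < N)%N.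
Proof.
rewrite ltnNge; apply/negP => leN; have := decomposable_vanish (top leN (FI k)).
by move/eqP; apply/negP/Fz.
Qed.

Lemma basis_all : exists b : nat -> seq {mpoly K[2]}, forall d,
  [/\ {in b d, forall x, deg_part I d x}, indep_mod (W d) (b d),
      forall h, deg_part I d h -> span_mod (W d) (b d) h,
      forall k, l k = d -> F k \in b d
    & (forall k x, (l k <= d)%N -> x \in b d -> x != F k -> x.@[z k] = 0)
      /\ ((N <= d)%N -> b d = [::])].
Proof.
have /fin_all_exists [b hb] := fun d : 'I_N => basis_degree d.
exists (fun d => if insub d is Some i then b i else [::]) => d.
case: insubP => [i _ <-|]; first by have [] := hb i; split=> //; split=> //; rewrite leqNgt ltn_ord.
rewrite -leqNgt => leN; split=> //.
- by move=> h Ih; apply: span_mod_sub; exact: top.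
- by move=> k lk; have := level_lt k; rewrite lk ltnNge leN.
Qed.

Lemma flatten_if (S : eqType) (b : S -> seq {mpoly K[2]}) (r : seq S) d : uniq r ->
  flatten [seq if e == d then b e else [::] | e <- r] = if d \in r then b d else [::].
Proof.
elim: r => //= e r IH /andP[er ur]; rewrite IH // inE eq_sym.
case: eqVneq => [->|] //=; rewrite ?(negPf er) ?cats0 //.
Qed.

(** The union of the bases of all degrees < N.  At z k, its elements of degree
    less than l k vanish by [below], and the others, F k excepted, by construction. *)
Lemma standard_basis_exists : exists B, standard_basis I B /\
  forall k, F k \in B /\ forall g, g \in B -> g != F k -> g.@[z k] = 0.
Proof.
have [b hb] := basis_all; pose B := flatten [seq b e | e <- iota 0 N].
have hW d : subspace (W d) := decomposable_subspace d hI.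
have bI d x : x \in b d -> deg_part I d x by have [h _ _ _ _] := hb d; apply: h.
have b0 d x : x \in b d -> x != 0.
  by have [_ h _ _ _] := hb d; apply: indep_neq0 h.
have inB x : x \in B -> exists2 d, (d < N)%N & x \in b d.
  by case/flatten_mapP => d; rewrite mem_iota => dN xd; exists d.
have bB d x : x \in b d -> x \in B.
  move=> xd; apply/flatten_mapP; exists d => //; rewrite mem_iota /= add0n ltnNge.
  by apply/negP => leN; have [_ _ _ _ [_ /(_ leN) bd]] := hb d; rewrite bd in xd.
have filterB d : [seq x <- B | x \is d.-homog] = b d.
  rewrite /B filter_flatten -map_comp.
  rewrite (eq_map (g := fun e => if e == d then b e else [::])); last first.
    move=> e /=; have [<-|ne] := eqVneq e d.
      by apply/all_filterP/allP => x /bI[].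
    apply/eqP; rewrite -(negbK (_ == _)) -has_filter; apply/hasPn => x xe.
    apply: contraNN ne => dx; apply/eqP.
    by apply: (dhomog_uniq (b0 _ _ xe) _ dx); have [] := bI _ _ xe.
  rewrite flatten_if ?iota_uniq // mem_iota /= add0n; case: ltnP => // leN.
  by have [_ _ _ _ [_ /(_ leN) ->]] := hb d.
have uB : uniq B.
  rewrite /B; have := iota_uniq 0 N; elim: (iota 0 N) => //= e r IH /andP[er /IH ur].
  rewrite cat_uniq ur andbT; have [_ [-> _] _ _ _] := hb e.
  apply/hasPn => x /flatten_mapP[d dr xd]; apply/negP => xe.
  case/negP: er; suff -> : e = d by [].
  have [[_ ex] [_ dx]] := (bI _ _ xe, bI _ _ xd).
  exact: (dhomog_uniq (b0 _ _ xe) ex dx).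
have BI x : x \in B -> I x by move=> /inB[d _ /bI[]].
exists B; split; last first.
  move=> k; have [_ _ _ Fk _] := hb (l k); split; first exact: bB (Fk _ _).
  move=> g /inB[d _ gd]; have [lekd|ltdk] := leqP (l k) d.
    by have [_ _ _ _ [h _]] := hb d; apply: h gd.
  by move=> _; apply: below ltdk (bI _ _ gd).
split.
- by split=> // x /inB[d _ /bI[_ dx]]; exists d.
- move=> h; split; last by apply: ideal_gen_min.
  have hgen := ideal_gen_ideal (fun x => x \in B); have [G0 GD GM] := hgen.
  have step d : (forall g, W d g -> ideal_gen (fun x => x \in B) g) ->
      forall g, deg_part I d g -> ideal_gen (fun x => x \in B) g.
    move=> WB g Ig; have [_ _ /(_ g Ig)[c hc] _ _] := hb d.
    rewrite -[g](subrK (\sum_(x <- b d) c x *: x)); apply: GD; first exact: WB.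
    rewrite big_seq; apply: (subspace_sum _ (ideal_subspace hgen)) => x /bB xB.
    by apply: idealZ => //; apply: ideal_gen_incl.
  have degB : forall d g, deg_part I d g -> ideal_gen (fun x => x \in B) g.
    elim=> [|d IH]; apply: step; apply: setprod_ind => // f1 f2 hf1 _.
      by rewrite hf1 mul0r.
    by apply: ideal_mulr => //; apply: IH.
  move=> Ih; rewrite (pihomog_partitionE (leqnn (mmeasure mdeg h))).
  apply: subspace_sum; first exact: ideal_subspace.
  by move=> d _; apply: (degB d); split; [apply: homI|apply: pihomogP].
- move=> d g Ig; have [_ _ /(_ g Ig)[c hc] _ _] := hb d; exists c.
  by rewrite -big_filter filterB.
move=> d c; rewrite -big_filter filterB => hc f fB df.
have [_ [_ h] _ _ _] := hb d; apply: h hc _ _.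
by rewrite -filterB mem_filter df.
Qed.

End Construction.

(** * The forms of I and the level of a point *)

Section Representation.
Variable K : closedFieldType.
Implicit Types (f g u : {mpoly K[2]}) (z w : 'I_2 -> K).
Implicit Types (s B : seq {mpoly K[2]}).
Variables (I : polyset K) (r : nat) (Phi : nat -> {mpoly K[2]}) (beta delta t : nat -> nat).
Hypotheses (hI : is_ideal I) (hrep : represents I r Phi beta delta t).

(** P_i = Phi_(i+1) ... Phi_r, of degree e_i; P_i S_(beta_i) is a part of I of
    degree d_i = beta_i + e_i. *)
Definition tailprod i := \prod_(i.+1 <= j < r.+2) Phi j.
Definition taildeg i := (\sum_(i.+1 <= j < r.+1) delta j)%N.
Definition gendeg i := (beta i + taildeg i)%N.
Local Notation P := tailprod.
Local Notation e := taildeg.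
Local Notation dg := gendeg.

Lemma tailprodE i : (i <= r)%N -> P i = \prod_(i.+1 <= j < r.+1) Phi j.
Proof.
by have [_ Phi1 _ _] := hrep => lir; rewrite /P big_nat_recr //= Phi1 mulr1.
Qed.

Lemma midprod_homog i j : (j <= r)%N ->
  \prod_(i.+1 <= k < j.+1) Phi k \is (\sum_(i.+1 <= k < j.+1) delta k)%N.-homog.
Proof.
have [hPhi _ _ _] := hrep => lejr; rewrite big_nat [(\sum_(_ <= _ < _) _)%N]big_nat.
apply: prod_homog => k /andP[lik lkj]; have [|_ _ //] := hPhi k.
by rewrite (leq_ltn_trans _ lik) //= -ltnS (leq_trans lkj).
Qed.

Lemma midprod_neq0 i j : (j <= r)%N -> \prod_(i.+1 <= k < j.+1) Phi k != 0.
Proof.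
have [hPhi _ _ _] := hrep => lejr; rewrite prodf_seq_neq0; apply/allP => k.
rewrite mem_index_iota /= => /andP[lik lkj]; have [|//] := hPhi k.
by rewrite (leq_ltn_trans _ lik) //= -ltnS (leq_trans lkj).
Qed.

Lemma tailprod_homog i : (i <= r)%N -> P i \is (e i).-homog.
Proof. by move=> leir; rewrite tailprodE //; apply: midprod_homog. Qed.

Lemma tailprod_neq0 i : (i <= r)%N -> P i != 0.
Proof. by move=> leir; rewrite tailprodE //; apply: midprod_neq0. Qed.

Lemma tailprod_split i j : (i <= j <= r)%N -> P i = \prod_(i.+1 <= k < j.+1) Phi k * P j.
Proof.
move=> /andP[leij lejr]; rewrite !tailprodE ?(leq_trans leij) //.
by rewrite (@big_cat_nat _ _ _ j.+1) //= ltnS ?leij.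
Qed.

Lemma taildeg_split i j : (i <= j <= r)%N -> e i = (\sum_(i.+1 <= k < j.+1) delta k + e j)%N.
Proof.
move=> /andP[leij lejr]; rewrite /e (@big_cat_nat _ _ _ j.+1) //= ltnS ?leij //.
Qed.

Lemma tailprod_last : P r = 1.
Proof. by rewrite tailprodE // big_geq. Qed.

Lemma taildeg_last : e r = 0%N.
Proof. by rewrite /e big_geq. Qed.

Lemma taildeg_rec i : (i < r)%N -> e i = (delta i.+1 + e i.+1)%N.
Proof. by move=> ltir; rewrite (@taildeg_split i i.+1) ?leqnSn // big_nat1. Qed.

Lemma tailprod_rec i : (i < r)%N -> P i = Phi i.+1 * P i.+1.
Proof. by move=> ltir; rewrite (@tailprod_split i i.+1) ?leqnSn // big_nat1. Qed.

Lemma beta_rec i : (i < r)%N -> (0 < t i.+1)%N /\ beta i.+1 = (beta i + delta i.+1 + t i.+1)%N.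
Proof. by have [_ _ hb _] := hrep => ltir; apply: (hb i.+1). Qed.

Lemma gendeg_rec i : (i < r)%N -> (dg i < dg i.+1)%N.
Proof.
move=> ltir; have [t0 be] := beta_rec ltir.
by rewrite /dg be (taildeg_rec ltir); lia.
Qed.

Lemma gendeg_lt i j : (i < j <= r)%N -> (dg i < dg j)%N.
Proof.
case/andP; elim: j => // j IH; rewrite ltnS leq_eqVlt => /predU1P[-> |ltij] ltjr.
  exact: gendeg_rec.
by apply: ltn_trans (gendeg_rec ltjr); apply: IH => //; apply: ltnW.
Qed.

Lemma gendeg_le i j : (i <= j <= r)%N -> (dg i <= dg j)%N.
Proof.
by case/andP; rewrite leq_eqVlt => /predU1P[->//|lt] le; apply/ltnW/gendeg_lt/andP.
Qed.

Lemma gendeg_leE i j : (i <= r)%N -> (j <= r)%N -> (dg i <= dg j)%N = (i <= j)%N.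
Proof.
move=> ir jr; apply/idP/idP => [|leij]; last by apply: gendeg_le; rewrite leij.
by apply: contraLR; rewrite -!ltnNge => lt; apply: gendeg_lt; rewrite lt.
Qed.

Lemma gendeg_ltE i j : (i <= r)%N -> (j <= r)%N -> (dg i < dg j)%N = (i < j)%N.
Proof. by move=> ir jr; rewrite !ltnNge gendeg_leE. Qed.

Lemma gendeg_inj i j : (i <= r)%N -> (j <= r)%N -> dg i = dg j -> i = j.
Proof.
by move=> ir jr eq; apply/eqP; rewrite eqn_leq -(gendeg_leE ir jr) -(gendeg_leE jr ir) eq leqnn.
Qed.

(** This inequality leaves room to interpolate in degree beta_i at beta_0 + 1
    points together with the zeros of Phi_1 ... Phi_i. *)
Lemma beta_ge i : (i <= r)%N -> (beta 0%N + \sum_(1 <= k < i.+1) delta k <= beta i)%N.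
Proof.
elim: i => [|i IH] leir; first by rewrite big_geq // addn0.
have [_ ->] := beta_rec leir; rewrite big_nat_recr //=.
by have := IH (ltnW leir); lia.
Qed.

Lemma tailprod_mul_in i m g : (i <= r)%N -> (beta i <= m)%N -> g \is m.-homog -> I (P i * g).
Proof.
have [_ _ _ hIr] := hrep; have [I0 ID IM] := hI => leir le.
have Ib h : forms (beta i) h -> I (P i * h).
  move=> hh; apply/hIr.
  exists (fun k : 'I_r.+1 => if k == i :> nat then P i * h else 0); split=> [k|].
    case: eqP => [->|_]; last exact: setprod0.
    by apply: ideal_gen_incl; exists h.
  rewrite (bigD1 (Ordinal (leir : (i < r.+1)%N))) //= eqxx big1 ?addr0 // => k.
  by rewrite -val_eqE /= => /negPf ->.
rewrite -(subnKC le) => /form_split; move: g; apply: setprod_ind; first by rewrite mulr0.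
  by move=> f h; rewrite mulrDr; apply: ID.
by move=> f h hf _; rewrite mulrA; apply: ideal_mulr => //; apply: Ib.
Qed.

(** The description of I_d: since P_j divides P_i for i <= j, a sum of two such
    multiples is a multiple of the one P_i with the larger index. *)
Definition tail_multiple d f := f = 0 \/ exists i g,
  [/\ (i <= r)%N, (dg i <= d)%N, g \is (d - e i).-homog & f = P i * g].

Lemma tail_multipleD d f g : tail_multiple d f -> tail_multiple d g -> tail_multiple d (f + g).
Proof.
case=> [->|[i [f1 [ir id hf1 ->]]]]; first by rewrite add0r.
case=> [->|[j [g1 [jr jd hg1 ->]]]]; first by rewrite addr0; right; exists i, f1.
right; wlog leij : i j f1 g1 ir jr id jd hf1 hg1 / (i <= j)%N => [H|].
  by have [/H|/ltnW/H] := leqP i j; last rewrite addrC; apply.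
exists j, (\prod_(i.+1 <= k < j.+1) Phi k * f1 + g1); split=> //.
  apply: rpredD => //; have := dhomogM (@midprod_homog i j jr) hf1.
  have := @taildeg_split i j; rewrite leij jr => /(_ isT) ei.
  by rewrite (_ : (_ + _)%N = d - e j)%N //; move: id; rewrite /dg; lia.
by rewrite (@tailprod_split i j) ?leij // mulrDr mulrA [_ * P j]mulrC.
Qed.

Lemma deg_part_tail d f : deg_part I d f -> tail_multiple d f.
Proof.
have [_ _ _ hIr] := hrep; move=> [/hIr[F [hF ->]] hf]; rewrite -(pihomog_dE hf) raddf_sum /=.
elim/big_ind: _; [by left|exact: tail_multipleD|move=> i _].
move: (F i) (hF i); apply: setprod_ind.
- by left; apply: pihomog0.
- by move=> g h; rewrite pihomogD; apply: tail_multipleD.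
have ir : (i <= r)%N by rewrite -ltnS.
move=> _ h [g hg ->] _; have := dhomogM (tailprod_homog ir) hg; rewrite addnC => hPg.
rewrite (pihomogMl _ _ hPg); case: leqP => lt; last by left.
right; exists i, (g * pihomog mdeg (d - dg i) h); split=> //; last by rewrite mulrA.
have := dhomogM hg (pihomogP mdeg (d - dg i) h).
by rewrite (_ : (_ + _)%N = d - e i)%N //; move: lt; rewrite /dg; lia.
Qed.

Lemma tail_decomposable d i g : (i <= r)%N -> (dg i < d)%N -> g \is (d - e i).-homog ->
  decomposable I d (P i * g).
Proof.
move=> ir; case: d => // d; rewrite ltnS => le.
have -> : (d.+1 - e i = (d - e i) + 1)%N by move: le; rewrite /dg; lia.
move=> /form_split; move: g; apply: setprod_ind; first by rewrite mulr0; apply: setprod0.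
  by move=> f h; rewrite mulrDr; apply: setprodD.
move=> f h hf hh; rewrite mulrA; apply: setprod_mul => //; split.
  by apply: tailprod_mul_in hf => //; move: le; rewrite /dg; lia.
have := dhomogM (tailprod_homog ir) hf.
by rewrite subnKC //; move: le; rewrite /dg; lia.
Qed.

Lemma level_exists z : exists i, (tailprod i).@[z] != 0.
Proof. by exists r; rewrite tailprod_last meval1 oner_neq0. Qed.

(** d_l, for l the level of z <> 0, is the least degree in which I has a form that
    is nonzero at z. *)
Definition level z := ex_minn (level_exists z).

Lemma level_neq0 z : (P (level z)).@[z] != 0.
Proof. by rewrite /level; case: ex_minnP. Qed.

Lemma level_le z : (level z <= r)%N.
Proof.
rewrite /level; case: ex_minnP => i _; apply.
by rewrite tailprod_last meval1 oner_neq0.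
Qed.

(** P_i divides P_l for l <= i, so P_i remains nonzero at z from the level on. *)
Lemma level_leE z i : (i <= r)%N -> (level z <= i)%N = ((P i).@[z] != 0).
Proof.
move=> ir; apply/idP/idP => [le|]; last by rewrite /level; case: ex_minnP => j _; apply.
have := level_neq0 z; rewrite (@tailprod_split (level z) i) ?le // mevalM.
by rewrite mulf_eq0 negb_or => /andP[].
Qed.

Lemma below_level z d f : (d < dg (level z))%N -> deg_part I d f -> f.@[z] = 0.
Proof.
move=> ltd /deg_part_tail[->|[i [g [ir id hg ->]]]]; first exact: meval0.
have := leq_ltn_trans id ltd; rewrite gendeg_ltE // ?level_le // ltnNge level_leE // negbK.
by rewrite mevalM => /eqP ->; rewrite mul0r.
Qed.

Lemma level_witness z : (exists i, z i != 0) ->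
  exists2 f, deg_part I (dg (level z)) f & f.@[z] != 0.
Proof.
move=> [i zi]; have lr := level_le z.
have hX := dhomogMn (beta (level z)) (linear_X_homog K i); rewrite mul1n in hX.
exists (P (level z) * 'X_i ^+ beta (level z)).
  split; first by apply: tailprod_mul_in hX.
  by have := dhomogM (tailprod_homog lr) hX; rewrite addnC.
by rewrite mevalM rmorphXn /= mevalXU mulf_neq0 ?level_neq0 // expf_neq0.
Qed.

Lemma power_in i : I ('X_i ^+ beta r).
Proof.
have hX := dhomogMn (beta r) (linear_X_homog K i); rewrite mul1n in hX.
by rewrite -['X_i ^+ _]mul1r -tailprod_last; apply: tailprod_mul_in hX.
Qed.

Lemma above_decomposable d f : (dg r < d)%N -> deg_part I d f -> decomposable I d f.
Proof.
move=> ltd /deg_part_tail[->|[i [g [ir id hg ->]]]]; first exact: setprod0.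
by apply: tail_decomposable => //; apply: leq_ltn_trans ltd; apply: gendeg_le; rewrite ir /=.
Qed.

(** The cardinality hypothesis is what interpolation in degree beta_i requires.  It
    gives the dual forms F k = P_i u for i = level (z k), and the corrections which
    make a form P_i g vanish at the points of level < i. *)
Lemma point_basis (homI : is_homogeneous I) (T : finType) (z : T -> 'I_2 -> K) :
  (forall k, exists i, z k i != 0) ->
  (forall j k, j != k -> cross (z j) (z k) != 0) ->
  (forall i, (i <= r)%N -> (#|[set k | (P i).@[z k] != 0%R]| <= (beta i).+1)%N) ->
  exists B, standard_basis I B /\ exists2 F : T -> {mpoly K[2]}, injective F
    & forall k, [/\ F k \in B, F k \is (dg (level (z k))).-homog & detects B (z k) (F k)].
Proof.
move=> nz ind cnt.
have interp i (y : T -> K) m : (i <= r)%N -> (beta i <= m)%N -> exists2 u, u \is m.-homog &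
    forall k, (level (z k) <= i)%N -> u.@[z k] = y k.
  move=> ir lem; have [||u hu hy] := @interpolation _ _ z [set k | (P i).@[z k] != 0] m y nz.
  - exact: ind.
  - by apply: leq_trans (cnt _ ir) _.
  by exists u => // k; rewrite level_leE // => Pk; apply: hy; rewrite inE.
have /fin_all_exists [F hF] : forall k, exists f, [/\ deg_part I (dg (level (z k))) f,
   f.@[z k] != 0 & forall j, (level (z j) <= level (z k))%N -> j != k -> f.@[z j] = 0].
  move=> k; have lr := level_le (z k).
  have [u hu uy] := interp (level (z k)) (fun j => (j == k)%:R) _ lr (leqnn _).
  exists (P (level (z k)) * u); split.
  - split; first exact: tailprod_mul_in hu.
    by have := dhomogM (tailprod_homog lr) hu; rewrite addnC.
  - by rewrite mevalM uy // eqxx mulr1 level_neq0.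
  - by move=> j le jk; rewrite mevalM uy // (negPf jk) mulr0.
have [||||||B [hB FB]] := @standard_basis_exists K I (dg r).+1 T z
    (fun k => dg (level (z k))) F hI homI.
- by move=> d g; apply: above_decomposable.
- by move=> k; have [] := hF k.
- by move=> k; have [] := hF k.
- by move=> j k; rewrite gendeg_leE ?level_le // => le jk; have [_ _] := hF k; apply.
- by move=> k d g; apply: below_level.
- move=> d h /[dup] Ih /deg_part_tail[->|[i [g [ir id hg he]]]].
    by exists 0; [exact: setprod0|move=> k _; rewrite subr0 meval0].
  (* A form P_i g with d_i < d is its own correction; for d_0 = d no point has
     smaller level. *)
  move: id; rewrite leq_eqVlt => /predU1P[de|ltd]; last first.
    by exists h; [rewrite he; apply: tail_decomposable|move=> k _; rewrite subrr meval0].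
  case: i => [|i] in ir hg he de *.
    exists 0; first exact: setprod0.
    by move=> k; rewrite -de gendeg_ltE ?level_le.
  (* The correction is P_i u = P_(i+1) Phi_(i+1) u, where u interpolates g / Phi_(i+1)
     at the points of level at most i. *)
  have ir' := ltnW ir; have [t0 be] := beta_rec ir.
  have [|u hu uy] := interp i (fun k => g.@[z k] / (Phi i.+1).@[z k])
     (beta i.+1 - delta i.+1)%N ir'; first by rewrite be; lia.
  exists (P i * u).
    apply: tail_decomposable => //; first by rewrite -de gendeg_ltE.
    by rewrite (_ : (d - e i)%N = beta i.+1 - delta i.+1)%N // -de /dg (taildeg_rec ir); lia.
  move=> k; rewrite -de gendeg_ltE ?level_le // ltnS => lk.
  rewrite he (tailprod_rec ir) mevalB !mevalM uy //.
  move: lk; rewrite level_leE // (tailprod_rec ir) mevalM mulf_eq0 negb_or => /andP[Pz _].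
  by rewrite mulrAC mulrCA divff // mulr1 mulrC subrr.
exists B; split=> //; exists F; last first.
  move=> k; have [[_ hk] Fk _] := hF k; have [FkB others] := FB k; split=> //.
move=> j k Fjk; apply/eqP/negPn/negP => jk.
have [[_ hj] Fj _] := hF j; have [[_ hk] _ Fk0] := hF k.
have Fk0' : F k != 0.
  by apply: contraNneq Fj => F0; rewrite Fjk F0 meval0.
have := dhomog_uniq Fk0' _ hk; rewrite -{1}Fjk => /(_ _ hj) /gendeg_inj el.
by case/negP: Fj; rewrite Fjk Fk0 // el // level_le.
Qed.

End Representation.

(** * Linear forms as points *)

Section Auxiliary.
Variable K : closedFieldType.
Implicit Types (f g u : {mpoly K[2]}) (z w p : 'I_2 -> K).
Implicit Types (s B : seq {mpoly K[2]}).

(** Excluded middle replaces the decidability of Q. *)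
Lemma prop_filter (Q : {mpoly K[2]} -> Prop) s : uniq s ->
  exists s', uniq s' /\ forall x, x \in s' <-> x \in s /\ Q x.
Proof.
elim: s => [_|x s IH /= /andP[xs /IH[s' [us' hs']]]].
  by exists [::]; split=> // x; split=> [|[]].
case: (classic (Q x)) => Qx; [exists (x :: s')|exists s']; split=> //=.
- by rewrite us' andbT; apply: contra xs => /hs'[].
- move=> y; rewrite !inE; split=> [/predU1P[->|/hs'[ys Qy]]|[/predU1P[->|ys] Qy]].
  + by rewrite eqxx.
  + by rewrite ys orbT.
  + by rewrite eqxx.
  + by rewrite [y \in s'](introT idP _) ?orbT //; apply/hs'.
- move=> y; rewrite inE; split=> [/hs'[ys Qy]|[/predU1P[->|ys] Qy]] //.
  + by rewrite ys orbT.
  + by apply/hs'.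
Qed.

Lemma fdegE d f : f != 0 -> f \is d.-homog -> fdeg f = d.
Proof. by move=> f0 hf; rewrite /fdeg; apply: (dhomog_uniq f0 _ hf); apply: dhomog_msize hf. Qed.

Lemma linear_lineform f : f \is 1.-homog -> exists p, f = lineform p.
Proof.
move=> /form_in_span[c ->]; exists (fun i => if i == 0 then c 0 else - c 1).
rewrite /lineform /= !big_ord_recl big_ord0 /= addr0 !expr0 !expr1 mul1r mulr1.
by rewrite scaleNr opprK; congr (_ *: _ + _ *: _); congr c; apply: val_inj.
Qed.

Lemma crossC z w : cross z w = - cross w z.
Proof. by rewrite /cross opprB mulrC [w 0 * _]mulrC. Qed.

Lemma cross_eq0 p w : (exists i, p i != 0) -> cross p w = 0 ->
  exists c, forall i, w i = c * p i.
Proof.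
move=> [i pi]; rewrite /cross => /eqP; rewrite subr_eq0 => /eqP hc; exists (w i / p i) => j.
apply: (mulIf pi); rewrite mulrAC divfK //.
have [->|->] := ord2P i; have [->|->] := ord2P j => //; first by rewrite mulrC hc mulrC.
by rewrite [RHS]mulrC hc mulrC.
Qed.

Lemma lineform_neq0 p : lineform p != 0 -> exists i, p i != 0.
Proof.
move=> /eqP L0; apply: NNPP => np; apply: L0; have p0 i : p i = 0.
  by apply/eqP/negPn/negP => pi; apply: np; exists i.
by rewrite /lineform !p0 !scale0r subrr.
Qed.

(** The combination eliminates one of the two variables. *)
Lemma lineform_combination p w (i : 'I_2) :
  exists j, w i *: lineform p + (- p i) *: lineform w = cross p w *: 'X_j.
Proof.
have [->|->] := ord2P i.
  by exists 0; rewrite /lineform /cross -!mul_mpolyC; ring.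
by exists 1; rewrite /lineform /cross -!mul_mpolyC; ring.
Qed.

Lemma cross_independent p w : lineform p != 0 ->
  (forall a b : K, a *: lineform p + b *: lineform w = 0 -> a = 0 /\ b = 0) ->
  cross p w != 0.
Proof.
move=> p0 ind; apply/eqP => c0; have [i] := lineform_neq0 p0.
have [j] := lineform_combination p w i; rewrite c0 scale0r => /ind[_ /eqP].
by rewrite oppr_eq0 => ->.
Qed.

End Auxiliary.

(** * Essential elements, the initial degree and the case of a constant gcd *)

Section EssentialElements.
Variable K : closedFieldType.
Implicit Types (f g u : {mpoly K[2]}) (z w p : 'I_2 -> K).
Implicit Types (s B : seq {mpoly K[2]}).
Variables (I : polyset K) (r : nat) (Phi : nat -> {mpoly K[2]}) (beta delta t : nat -> nat).
Hypotheses (hI : is_ideal I) (homI : is_homogeneous I) (hrep : represents I r Phi beta delta t).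
Local Notation P := (tailprod r Phi).
Local Notation e := (taildeg r delta).
Local Notation dg := (gendeg r beta delta).
Local Notation lev := (level hrep).

Lemma standard_homog B : standard_basis I B -> {in B, forall g, exists d, g \is d.-homog}.
Proof. by move=> [[_ hB] _ _ _] g /hB. Qed.

(** The forms of degree < d of I are generated by elements of B other than f, all
    of which vanish at z. *)
Lemma detects_below B z f d : standard_basis I B -> f \is d.-homog -> detects B z f ->
  forall d' h, (d' < d)%N -> deg_part I d' h -> h.@[z] = 0.
Proof.
move=> hB hf [zi fz others].
have f0 : f != 0 by apply: contraNneq fz => ->; rewrite meval0.
have step d' : (forall h, decomposable I d' h -> h.@[z] = 0) -> (d' < d)%N ->
    forall h, deg_part I d' h -> h.@[z] = 0.
  move=> Wz lt h /(standard_span hB)[c /Wz]; rewrite mevalB; set u := \sum_(_ <- _) _.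
  suff -> : u.@[z] = 0 by rewrite subr0.
  rewrite raddf_sum /= big_seq big1 // => x; rewrite mem_filter => /andP[dx xB].
  rewrite mevalZ others ?mulr0 //.
  by apply: contraTneq lt => xf; rewrite xf in dx; rewrite (dhomog_uniq f0 dx hf) ltnn.
elim=> [|d' IH] h lt.
  apply: step lt h; apply: setprod_ind; first exact: meval0.
    by move=> g1 g2 h1 h2; rewrite mevalD h1 h2 addr0.
  by move=> g1 g2 -> _; rewrite mul0r meval0.
apply: (step _ _ lt); apply: setprod_ind; first exact: meval0.
  by move=> g1 g2 h1 h2; rewrite mevalD h1 h2 addr0.
by move=> g1 g2 /(IH _ (ltnW lt)) h1 _; rewrite mevalM h1 mul0r.
Qed.

(** I has no form of degree < d_l that is nonzero at z and has one of degree d_l,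
    for l the level of z; on the other side, the element detected by z is the only
    one of B that is nonzero at z. *)
Lemma detects_level B z f d : standard_basis I B -> f \in B -> f \is d.-homog ->
  detects B z f -> d = dg (lev z).
Proof.
move=> hB fB hf det; have [zi fz _] := det.
have [lt|gt|//] := ltngtP d (dg (lev z)); case/eqP: fz.
  apply: (below_level lt); split=> //; exact: standard_in hB fB.
have [h Ih /eqP hz] := level_witness hI hrep zi; case: hz.
exact: detects_below hB hf det _ _ gt Ih.
Qed.

Lemma essential_detects B f : standard_basis I B -> f \in B -> ~ inessential B f ->
  exists z, detects B z f.
Proof.
move=> hB fB; have [_ IB _ _] := hB.
exact: (essential_detected (power_in hI hrep) IB (standard_homog hB) fB).
Qed.

Lemma detects_unique B z f g : f \in B -> g \in B -> detects B z f -> detects B z g -> f = g.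
Proof.
move=> fB gB [_ fz _] [_ _ hg]; apply/eqP/negPn/negP => fg; case/eqP: fz.
exact: hg.
Qed.

Lemma detects_scale B z w c f : standard_basis I B -> f \in B ->
  (exists i, w i != 0) -> (forall i, z i = c * w i) -> detects B z f -> detects B w f.
Proof.
move=> hB fB wi zc [[i zi] fz others].
have c0 : c != 0 by apply: contraNneq zi => c0; rewrite zc c0 mul0r.
have scale g : g \in B -> (g.@[z] == 0) = (g.@[w] == 0).
  move=> /(standard_homog hB)[d hg]; rewrite (meval_eq g zc) (form_scale c w hg).
  by rewrite mulf_eq0 expf_eq0 (negPf c0) andbF.
split=> //; first by rewrite -scale.
by move=> g gB gf; apply/eqP; rewrite -scale //; apply/eqP/others.
Qed.

Lemma first_degree d f : f != 0 -> deg_part I d f -> (dg 0 <= d)%N.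
Proof.
move=> f0 /(deg_part_tail hrep)[f00|[i [g [ir id _ _]]]]; first by rewrite f00 eqxx in f0.
by apply: leq_trans id; apply: (gendeg_le hrep).
Qed.

Lemma decomposable_first f : decomposable I (dg 0) f -> f = 0.
Proof.
move: f; apply: setprod_ind => // [f g -> ->|f g]; first by rewrite addr0.
case ed: (dg 0) => [|d] /=; first by move=> -> _; rewrite mul0r.
move=> If _; have [->|f0] := eqVneq f 0; first by rewrite mul0r.
by have := first_degree f0 If; rewrite ed ltnn.
Qed.

Lemma first_form z : (exists i, z i != 0) -> (P 0).@[z] != 0 ->
  exists2 f, deg_part I (dg 0) f & f.@[z] != 0.
Proof.
move=> zi; rewrite -(level_leE hrep) // leqn0 => /eqP lz.
by have := level_witness hI hrep zi; rewrite lz.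
Qed.

Lemma tail0_neq0 : P 0 != 0. Proof. exact: (tailprod_neq0 hrep). Qed.
Lemma tail0_homog : P 0 \is (e 0).-homog. Proof. exact: (tailprod_homog hrep). Qed.

Lemma affine_neq0 (x : K) : exists i, affine_pt x i != 0.
Proof. by exists 1; rewrite /affine_pt oner_neq0. Qed.

(** A basis without elements of degree d_0 could not generate the nonzero forms of
    this degree that I contains, since I has no nonzero form of smaller degree. *)
Lemma is_alpha_first a : is_alpha I a -> a = dg 0.
Proof.
case=> B [hB [f fB fa] min]; have [d df] := standard_homog hB fB.
have f0 := standard_neq0 hI hB fB; apply/eqP; rewrite eqn_leq andbC.
rewrite -{1}fa (fdegE f0 df) (first_degree f0 (conj (standard_in hB fB) df)) /=.
rewrite leqNgt; apply/negP => lt.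
have [x [_ /(_ 0) xP]] := form_avoid 1 tail0_homog tail0_neq0.
have [h Ih] := first_form (affine_neq0 _) xP.
have [c] := standard_span hB Ih; rewrite big_seq big1 ?subr0 => [/decomposable_first ->|g].
  by rewrite meval0 eqxx.
rewrite mem_filter => /andP[dg0 gB]; have := min g gB.
by rewrite (fdegE (standard_neq0 hI hB gB) dg0) leqNgt lt.
Qed.

(** I_(d_0) is P_0 S_(beta_0), of dimension beta_0 + 1. *)
Lemma size_first B : standard_basis I B -> (size (in_degree (dg 0) B) <= (beta 0).+1)%N.
Proof.
move=> hB; have hW := decomposable_subspace (dg 0) hI.
apply: (indep_mod_size (e := fun i : 'I_(beta 0).+1 => P 0 * ('X_0 ^+ i * 'X_1 ^+ (beta 0 - i)))
  hW (standard_indep (dg 0) hB)) => f.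
rewrite mem_filter => /andP[df fB].
have [->|[i [g [ir id hg ->]]]] := deg_part_tail hrep (conj (standard_in hB fB) df).
  by exists (fun=> 0); rewrite big1 ?subr0; [have [] := hW|move=> j _; rewrite scale0r].
have i0 : i = 0%N.
  by move: id; rewrite (gendeg_leE hrep) // leqn0 => /eqP.
move: hg; rewrite i0 /gendeg addnK => /form_in_span[c ->]; exists c.
rewrite mulr_sumr -sumrB big1; first by have [] := hW.
by move=> j _; rewrite -(scalerAr (c j)) subrr.
Qed.

(** A strongly inessential f would have degree d_0, the only degree of generators,
    and f together with the forms of this degree vanishing at a point z with
    f(z) <> 0 generates I; there z detects f. *)
Lemma not_strong_of_degree0 f : r = 0%N -> ~ strongly_inessential I f.
Proof.
move=> r0 [d [[If df] ndec noness]]; have dgr : dg r = dg 0 := congr1 dg r0.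
have f0 : f != 0 by apply/eqP => f0; apply: ndec; rewrite f0; apply: setprod0.
have dE : d = dg 0.
  apply/eqP; rewrite eqn_leq (first_degree f0 (conj If df)) andbT leqNgt; apply/negP => lt.
  apply: ndec; apply: decomposable_gen; apply: (above_decomposable hI hrep) => //.
  by rewrite dgr.
have [x [_ /(_ 0) fx]] := form_avoid 1 df f0; set z := affine_pt _ in fx.
have [||||||B [hB FB]] := @standard_basis_exists K I (dg r).+1 unit (fun=> z)
    (fun=> dg 0) (fun=> f) hI homI.
- by move=> d' g; apply: (above_decomposable hI hrep).
- by move=> _; rewrite -dE.
- by [].
- by move=> [] [].
- move=> _ d' g lt Ig; have [->|g0] := eqVneq g 0; first exact: meval0.
  by have := first_degree g0 Ig; rewrite leqNgt lt.
- move=> d' h Ih; have [le|lt] := leqP d' (dg 0).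
    by exists 0 => //; exact: setprod0.
  exists h => [|_ _]; last by rewrite subrr meval0.
  by apply: (above_decomposable hI hrep) => //; rewrite dgr.
have [fB others] := FB tt; apply: (@detected_essential _ B z f); last exact: noness.
by split=> //; apply: affine_neq0.
Qed.

Lemma generated_first : r = 0%N -> same_set I (ideal_gen (@forms K (dg 0))).
Proof.
move=> r0; have P0 : P 0 = 1 by rewrite -(tailprod_last hrep); apply: congr1.
have e0 : e 0 = 0%N := etrans (congr1 e (esym r0)) (taildeg_last r delta).
have -> : dg 0 = beta 0 by rewrite /gendeg e0 addn0.
have [_ _ _ hIr] := hrep => f; split; last first.
  apply: ideal_gen_min => // g hg; rewrite -[g]mul1r -P0.
  exact: (tailprod_mul_in hI hrep _ (leqnn _) hg).
move=> /hIr[F [hF ->]]; have hG := ideal_gen_ideal (@forms K (beta 0)).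
apply: subspace_sum; first exact: ideal_subspace.
move=> i _; apply: ideal_gen_min (hF i) => // _ [g hg ->]; have [_ _ IM] := hG.
have i0 : i = 0%N :> nat by apply/eqP; rewrite -leqn0 -r0 -ltnS.
by apply: IM; apply: ideal_gen_incl; rewrite -i0.
Qed.

End EssentialElements.

(** * Counting in an e-maximal basis *)

Section Count.
Variable K : closedFieldType.
Implicit Types (f g u : {mpoly K[2]}) (z w : 'I_2 -> K).
Implicit Types (s B : seq {mpoly K[2]}).
Variables (I : polyset K) (r : nat) (Phi : nat -> {mpoly K[2]}) (beta delta t : nat -> nat).
Hypotheses (hI : is_ideal I) (homI : is_homogeneous I) (hrep : represents I r Phi beta delta t).
Local Notation P := (tailprod r Phi).
Local Notation e := (taildeg r delta).
Local Notation dg := (gendeg r beta delta).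
Local Notation lev := (level hrep).
Variables (v : nat) (p : 'I_v -> 'I_2 -> K).
Hypothesis p_neq0 : forall k, exists i, p k i != 0.
Hypothesis p_indep : forall j k, j != k -> cross (p j) (p k) != 0.
Hypothesis zerosP : forall z, (P 0).@[z] = 0 <-> exists k, cross (p k) z = 0.

Lemma tail0_p k : (P 0).@[p k] = 0.
Proof. by apply/zerosP; exists k; rewrite cross_self. Qed.

Lemma level_p k : (0 < lev (p k))%N.
Proof. by rewrite ltnNge level_leE // tail0_p eqxx. Qed.

Lemma gendeg_level_p k : dg (lev (p k)) != dg 0.
Proof.
rewrite neq_ltn orbC (gendeg_ltE hrep) ?level_p //; exact: level_le.
Qed.

(** All p k are zeros of P_0 = (Phi_1 ... Phi_i) P_i, so those which are not zeros
    of P_i are zeros of the form Phi_1 ... Phi_i. *)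
Lemma zeros_tail_bound i : (i <= r)%N ->
  (#|[set k | (P i).@[p k] != 0%R]| <= \sum_(1 <= k < i.+1) delta k)%N.
Proof.
move=> ir; apply: (zeros_bound p_neq0 p_indep (midprod_homog hrep 0 ir) (midprod_neq0 hrep 0 ir)).
move=> k; rewrite inE => Pk; have := tail0_p k.
rewrite (@tailprod_split _ _ _ _ _ _ _ hrep 0 i) // mevalM.
by move/eqP; rewrite mulf_eq0 (negPf Pk) orbF => /eqP.
Qed.

(** beta_0 + 1 points off the zeros of P_0 are added to the p k.  They have level 0
    and detect the elements of degree d_0. *)
Lemma special_basis : exists (x : 'I_(beta 0).+1 -> K) (B : seq {mpoly K[2]})
    (F : 'I_(beta 0).+1 + 'I_v -> {mpoly K[2]}),
  let z k := match k with inl j => affine_pt (x j) | inr i => p i end in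
  [/\ forall j, lev (affine_pt (x j)) = 0%N, standard_basis I B, injective F
    & forall k, [/\ F k \in B, F k \is (dg (lev (z k))).-homog & detects B (z k) (F k)]].
Proof.
have [x [xinj xP]] := form_avoid (beta 0).+1 (tail0_homog hrep) (tail0_neq0 hrep).
pose z (k : 'I_(beta 0).+1 + 'I_v) := match k with inl j => affine_pt (x j) | inr i => p i end.
have pq k j : cross (p k) (affine_pt (x j)) != 0.
  by apply: contraNneq (xP j) => c0; apply/eqP/zerosP; exists k.
have [|||B [hB [F Finj hF]]] := @point_basis _ _ _ _ _ _ _ hI hrep homI _ z.
- by case=> j; [apply: affine_neq0|apply: p_neq0].
- case=> j [k|k] jk.
  + rewrite cross_affine subr_eq0; apply: contraNneq jk => /xinj ->; exact: eqxx.
  + by rewrite crossC oppr_eq0 pq.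
  + exact: pq.
  + by apply: p_indep; apply: contraNneq jk => ->.
- move=> i ir; apply: leq_trans (_ : (beta 0).+1 + \sum_(1 <= k < i.+1) delta k <= _)%N.
    pose A := [set k : 'I_v | (P i).@[p k] != 0].
    apply: (@leq_trans #|(inl @: [set: 'I_(beta 0).+1]) :|: (inr @: A)|).
      apply/subset_leq_card/subsetP => -[j|k]; rewrite !inE => hk.
        by rewrite imset_f // inE.
      by rewrite orbC imset_f // inE.
    rewrite (leq_trans (leq_card_setU _ _)) // leq_add //.
      by rewrite (leq_trans (leq_imset_card _ _)) // cardsT card_ord.
    by rewrite (leq_trans (leq_imset_card _ _)) // zeros_tail_bound.
  by rewrite addSn ltnS (beta_ge hrep).
exists x, B, F; split=> // j; apply/eqP; rewrite -leqn0 level_leE //.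
Qed.

(** The special basis has, in degree d, a different essential element for every
    point of this degree. *)
Lemma nu_e_lower d n : is_nu_e I d n ->
  (d = dg 0 -> ((beta 0).+1 <= n)%N) /\ (#|[set k | dg (lev (p k)) == d]| <= n)%N.
Proof.
move=> [_ hn]; have [x [B [F]]] := special_basis; set z := (X in let _ := X in _).
move=> [xlev hB Finj hF]; have [[uB _] _ _ _] := hB.
have [s [us hs]] := prop_filter (fun f => forms d f /\ ~ inessential B f) uB.
have card_s : has_card (essential_of_degree B d) (size s).
  by exists s; split=> // f; split=> [/hs[fB [df ef]]|[fB df ef]] //; apply/hs.
have Fs k : dg (lev (z k)) = d -> F k \in s.
  move=> kd; have [FB Fd Fz] := hF k; apply/hs; split=> //.
  by split; [rewrite /forms -kd|exact: detected_essential Fz].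
have bound (A : {set 'I_(beta 0).+1 + 'I_v}) :
    (forall k, k \in A -> dg (lev (z k)) = d) -> (#|A| <= n)%N.
  move=> hA; apply: leq_trans (hn B _ hB card_s); rewrite cardE -(size_map F).
  apply: uniq_leq_size; first by rewrite map_inj_uniq ?enum_uniq.
  by move=> f /mapP[k]; rewrite mem_enum => /hA/Fs kd ->.
split=> [d0|].
  have := bound (inl @: setT); rewrite card_imset ?cardsT ?card_ord; last by move=> ? ? [].
  by apply=> _ /imsetP[j _ ->] /=; rewrite xlev.
have := bound (inr @: [set k | dg (lev (p k)) == d]).
rewrite card_imset; last by move=> ? ? [].
by apply=> _ /imsetP[k + ->] /=; rewrite inE => /eqP.
Qed.

Section EMaximal.
Variables (B : seq {mpoly K[2]}) (eB : e_maximal I B).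
Let hB : standard_basis I B := eB.1.

(** There are at least beta_0 + 1 essential elements of degree d_0, and B has at
    most beta_0 + 1 elements of this degree. *)
Lemma first_essential f : f \in B -> f \is (dg 0).-homog -> ~ inessential B f.
Proof.
move=> fB df; have [n hn [s [us szs hs]]] := eB.2 (dg 0).
have [/(_ erefl) le_n _] := nu_e_lower hn.
have sub : {subset s <= in_degree (dg 0) B}.
  by move=> g /hs[gB dgg _]; rewrite mem_filter gB andbT.
rewrite -szs in le_n.
have [_ eq_s] := uniq_min_size us sub (leq_trans (size_first hI hrep hB) le_n).
have : f \in s by rewrite eq_s mem_filter df.
by case/hs.
Qed.

Lemma size_first_eq : size (in_degree (dg 0) B) = (beta 0).+1.
Proof.
apply/eqP; rewrite eqn_leq (size_first hI hrep hB) /=.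
have [n hn [s [us szs hs]]] := eB.2 (dg 0); have [/(_ erefl) le_n _] := nu_e_lower hn.
rewrite (leq_trans le_n) // -szs; apply: uniq_leq_size => //.
by move=> g /hs[gB dgg _]; rewrite mem_filter gB andbT.
Qed.

(** A point which detects an element of degree other than d_0 has positive level,
    so it is a zero of P_0 and hence proportional to some p k. *)
Lemma essential_root f : f \in B -> ~~ (f \is (dg 0).-homog) -> ~ inessential B f ->
  exists k, detects B (p k) f.
Proof.
move=> fB df /(essential_detects hI hrep hB fB)[z det].
have [d hd] := standard_homog hB fB; have dE := detects_level hI hrep hB fB hd det.
have /zerosP[k ck] : (P 0).@[z] = 0.
  apply/eqP; apply: contraNT df; rewrite -(level_leE hrep) // leqn0 => /eqP lz.
  by move: hd; rewrite dE lz.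
have [c hc] := cross_eq0 (p_neq0 k) ck; exists k.
exact: detects_scale hB fB (p_neq0 k) hc det.
Qed.

(** A choice of a p k which detects it, for every essential element of degree d,
    is injective.  By e-maximality there are at least as many such elements as
    p k of this degree, so the choice is bijective: every p k of this degree
    detects an element, and distinct ones detect distinct elements. *)
Lemma roots_essential d : d != dg 0 ->
  (forall k, dg (lev (p k)) = d -> exists2 f, f \in B & detects B (p k) f) /\
  (forall j k f, dg (lev (p j)) = d -> dg (lev (p k)) = d -> f \in B ->
     detects B (p j) f -> detects B (p k) f -> j = k).
Proof.
move=> d0; have [n hn [s [us szs hs]]] := eB.2 d.
have [_ le_n] := nu_e_lower hn; rewrite -szs in le_n.
have sB (i : 'I_(size s)) : [/\ s`_i \in B, forms d s`_i & ~ inessential B s`_i].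
  by apply/hs/mem_nth.
have /fin_all_exists [kap hkap] : forall i : 'I_(size s), exists k, detects B (p k) s`_i.
  move=> i; have [iB di ei] := sB i; apply: essential_root => //.
  apply: contra d0 => d0; apply/eqP.
  exact: (dhomog_uniq (standard_neq0 hI hB iB) di d0).
have kinj : injective kap.
  move=> i j kij; apply/eqP; rewrite -val_eqE /= -(nth_uniq 0 (ltn_ord i) (ltn_ord j) us).
  have [iB _ _] := sB i; have [jB _ _] := sB j.
  by apply/eqP; apply: (detects_unique iB jB (hkap i)); rewrite kij.
have kd i : dg (lev (p (kap i))) = d.
  by have [iB di _] := sB i; rewrite -(detects_level hI hrep hB iB di (hkap i)).
have kim : kap @: setT = [set k | dg (lev (p k)) == d].
  apply/eqP; rewrite eqEcard card_imset // cardsT card_ord le_n andbT.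
  by apply/subsetP => _ /imsetP[i _ ->]; rewrite inE kd.
have ksurj k : dg (lev (p k)) = d -> exists i, k = kap i.
  move=> kd'; have : k \in kap @: setT by rewrite kim inE kd'.
  by case/imsetP => i _ ->; exists i.
split=> [k /ksurj[i ->]|j k f /ksurj[a ->] /ksurj[b ->] fB da db].
  by exists s`_i => //; have [iB _ _] := sB i.
congr (kap _).
have [aB _ _] := sB a; have [bB _ _] := sB b.
apply/val_inj/eqP; rewrite /= -(nth_uniq 0 (ltn_ord a) (ltn_ord b) us).
rewrite (detects_unique aB fB (hkap a) da); apply/eqP.
exact: detects_unique fB bB db (hkap b).
Qed.

Lemma root_detected k : exists2 f, f \in B & detects B (p k) f.
Proof.
by have [h _] := roots_essential (gendeg_level_p k); apply: h.
Qed.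

Lemma detects_root_inj j k f : f \in B -> detects B (p j) f -> detects B (p k) f -> j = k.
Proof.
move=> fB dj dk; have [d hd] := standard_homog hB fB.
have ej := detects_level hI hrep hB fB hd dj; have ek := detects_level hI hrep hB fB hd dk.
have [_ h] := roots_essential (gendeg_level_p k).
by apply: h dj dk => //; rewrite -ek.
Qed.

(** If f were essential in another standard basis, it would be nonzero at some
    p k.  In B, that p k detects an element, which could only be f itself. *)
Lemma inessential_strong f : f \in B -> inessential B f -> strongly_inessential I f.
Proof.
move=> fB inf; have [d hd] := standard_homog hB fB.
have dfirst : d != dg 0.
  by apply/eqP => d0; case: (first_essential fB _ inf); rewrite -d0.
exists d; split; first by split=> //; apply: standard_in hB fB.
  move=> /(gen_decomposable hd) Wf; have [_ h] := standard_indep d hB.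
  have fd : f \in in_degree d B by rewrite mem_filter hd.
  have := h (fun g => (g == f)%:R); rewrite sum_delta //; last by have [] := standard_indep d hB.
  by move=> /(_ Wf f fd)/eqP; rewrite eqxx oner_eq0.
move=> B' hB' fB'; apply: NNPP => ess.
have [z det] := essential_detects hI hrep hB' fB' ess.
have dE := detects_level hI hrep hB' fB' hd det.
have /zerosP[k ck] : (P 0).@[z] = 0.
  apply/eqP; apply: contraNT dfirst; rewrite -(level_leE hrep) // leqn0 => /eqP lz.
  by rewrite dE lz.
have [c hc] := cross_eq0 (p_neq0 k) ck.
have [_ fz _] := detects_scale hB' fB' (p_neq0 k) hc det.
have [g gB detg] := root_detected k; have [_ _ others] := detg.
have fg : f = g by apply/eqP/negPn/negP => fg; case/eqP: fz; apply: others.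
by apply: (detected_essential detg); rewrite -fg.
Qed.

(** B splits into the beta_0 + 1 elements of degree d_0, the v elements detected by
    the p k, and the inessential elements. *)
Lemma strong_card : has_card (fun f => f \in B /\ strongly_inessential I f)
  (size B - (beta 0).+1 - v).
Proof.
have [[uB _] _ _ _] := hB.
have [X [uX hX]] := prop_filter (inessential B) uB.
have /fin_all_exists2 [phi phiB phidet] := root_detected.
have phi_inj : injective phi.
  by move=> j k jk; apply: (detects_root_inj (phiB j) (phidet j)); rewrite jk.
pose E := [seq phi k | k : 'I_v].
have uE : uniq E by rewrite map_inj_uniq ?enum_uniq.
have szE : size E = v by rewrite size_map -cardE card_ord.
have inE f : (f \in E) <-> [/\ f \in B, ~~ (f \is (dg 0).-homog) & ~ inessential B f].
  split=> [/imageP[k _ ->]|[fB df ess]].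
    split=> //; last exact: detected_essential (phidet k).
    apply/negP => d0; have := detects_level hI hrep hB (phiB k) d0 (phidet k).
    by move/eqP; rewrite eq_sym (negPf (gendeg_level_p k)).
  have [k det] := essential_root fB df ess.
  by rewrite (detects_unique fB (phiB k) det (phidet k)) map_f // mem_enum.
have perm : perm_eq B (in_degree (dg 0) B ++ E ++ X).
  apply: uniq_perm => //.
    rewrite !cat_uniq filter_uniq // uE uX /= andbT; apply/andP; split.
      apply/hasPn => f; rewrite mem_cat mem_filter => /orP[/inE[_ /negPf -> _] //|].
      move/hX => [fB inf]; apply/negP => /andP[df _].
      exact: first_essential fB df inf.
    by apply/hasPn => f /hX[fB inf]; apply/negP => /inE[_ _].
  move=> f; apply/idP/idP; rewrite !mem_cat mem_filter.
    move=> fB; rewrite fB andbT; case: (boolP (f \is _)) => //= df.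
    case: (classic (inessential B f)) => inf; last by rewrite (introT idP (proj2 (inE f) _)).
    by rewrite orbC (introT idP (proj2 (hX f) _)).
  by case/or3P => [/andP[_ ->]|/inE[->]|/hX[->]].
exists X; split=> //.
  by rewrite (perm_size perm) !size_cat szE size_first_eq !addKn.
move=> f; split=> [/hX[fB inf]|[fB [d [_ _ strong]]]]; last by apply/hX; split=> //; apply: strong.
by split=> //; apply: inessential_strong.
Qed.

End EMaximal.
End Count.

Theorem theorem4p1 (K : closedFieldType) (I : polyset K) (r : nat)
    (Phi_ : nat -> {mpoly K[2]}) (beta delta_ t : nat -> nat)
    (hI : in_F2 I) (hrep : represents I r Phi_ beta delta_ t) :
  let Phi := \prod_(1 <= i < r.+1) Phi_ i in
  let delta := fdeg Phi in
  ((1 <= delta)%N ->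
     forall (v : nat) (H : 'I_v -> {mpoly K[2]}) (mu : 'I_v -> nat),
       (forall i, H i \is 1.-homog) ->
       pairwise_independent H ->
       (forall i, (1 <= mu i)%N) ->
       (\sum_(i < v) mu i)%N = delta ->
       Phi = \prod_(i < v) H i ^+ mu i ->
       forall B, e_maximal I B ->
         has_card (fun f => f \in B /\ strongly_inessential I f) (delta - v)%N)
  /\
  (delta = 0%N ->
     (forall alpha, is_alpha I alpha ->
        same_set I (ideal_gen (@forms K alpha))) /\
     (forall f, ~ strongly_inessential I f)).
Proof.
have [idI homI _ [a [ha [B0 [hB0 szB0]]]]] := hI.
have PhiE : \prod_(1 <= i < r.+1) Phi_ i = tailprod r Phi_ 0 by rewrite (tailprodE hrep).
have aE := is_alpha_first idI hrep ha.
have degE : fdeg (\prod_(1 <= i < r.+1) Phi_ i) = taildeg r delta_ 0.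
  by rewrite PhiE; apply: fdegE (tail0_neq0 hrep) (tail0_homog hrep).
move=> Phi delta; split=> [_ v H mu Hlin Hind mu1 _ PhiH B eB|delta0].
  have H0 i : H i != 0.
    have : Phi != 0 by rewrite /Phi PhiE (tail0_neq0 hrep).
    rewrite PhiH => /prodf_neq0 /(_ i isT); by rewrite expf_eq0 mu1.
  have /fin_all_exists [p Hp] := fun i => linear_lineform (Hlin i).
  have -> : (delta - v = size B - (beta 0).+1 - v)%N.
    by rewrite (standard_size_eq idI eB.1 hB0) szB0 aE /delta degE /gendeg; lia.
  apply: (@strong_card K I r Phi_ beta delta_ t idI homI hrep v p) => //.
  - by move=> k; apply: lineform_neq0; rewrite -Hp.
  - by move=> j k jk; apply: cross_independent; rewrite -!Hp //; apply: Hind.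
  - move=> z; rewrite -PhiE -/Phi PhiH rmorph_prod /=; split.
      move/eqP/prodf_eq0 => [k _]; rewrite rmorphXn /= expf_eq0 Hp lineform_eval => /andP[_ /eqP].
      by exists k.
    move=> [k ck]; apply/eqP/prodf_eq0; exists k => //.
    by rewrite rmorphXn /= expf_eq0 mu1 Hp lineform_eval ck eqxx.
have r0 : r = 0%N.
  case: (posnP r) => // rpos; have [hPhi _ _ _] := hrep.
  have [|_ d1 _] := hPhi 1%N; first by rewrite rpos.
  by move: delta0; rewrite /delta degE (taildeg_rec _ rpos); lia.
split=> [alpha /(is_alpha_first idI hrep) ->|f].
  exact: generated_first idI hrep r0.
exact: (not_strong_of_degree0 idI homI hrep r0).
Qed.
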